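(* Let $k=\mathbb{Q}$ or $k=\mathbb{Z}/p\mathbb{Z}$ for some prime $p$. Then the interleaving distance $d_I$ on isomorphism classes of $B_n$-persistence modules over $k$ is $\mathcal{R}_1$-optimal.
   Context: Fix $n\ge1$. $B_n=k[\mathbb{R}_{\ge0}^n]$ is the monoid ring of $(\mathbb{R}^n_{\ge0},+)$. A $B_n$-persistence module is a $B_n$-module $M$ with a $k$-vector space decomposition $M=\bigoplus_{a\in\mathbb{R}^n}M_a$ such that $x_i^{\alpha}(M_a)\subset M_{a+\alpha \mathbf{e}_i}$ for all $a$, $\alpha\ge0$; morphisms are module homomorphisms $f$ with $f(M_a)\subset N_a$. For $a\le b$ (product order) the transition map $\varphi_M(a,b):M_a\to M_b$ is multiplication by $x_1^{b_1-a_1}\cdots x_n^{b_n-a_n}$. For $\epsilon\ge0$ let $\vec\epsilon=(\epsilon,\dots,\epsilon)$, $M(\epsilon)_a=M_{a+\vec\epsilon}$, $f(\epsilon)_a=f_{a+\vec\epsilon}$, and $S(M,\epsilon):M\to M(\epsilon)$ with $S(M,\epsilon)_a=\varphi_M(a,a+\vec\epsilon)$. $M,N$ are $\epsilon$-interleaved if there are morphisms $f:M\to N(\epsilon)$, $g:N\to M(\epsilon)$ with $g(\epsilon)\circ f=S(M,2\epsilon)$ and $f(\epsilon)\circ g=S(N,2\epsilon)$. $d_I(M,N)=\inf\{\epsilon\ge0: M,N\text{ are }\epsilon\text{-interleaved}\}\in[0,\infty]$. Pseudometrics take values in $[0,\infty]$. For a topological space $T$ and a (not necessarily continuous) function $g:T\to\mathbb{R}^n$,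 $F^S(T,g)$ is the filtration with $F^S(T,g)_a=\{x\in T: g(x)\le a\}$ and inclusions; $H_i\circ F^S(T,g)$ is the $B_n$-persistence module with $a$-th summand the singular homology $H_i(F^S(T,g)_a;k)$ and transition maps induced by inclusions. A relative structure on a set (or class) $Y$ is a triple $\mathcal{R}=(\mathcal{T},X_{\mathcal{T}},f_{\mathcal{T}})$ with $\mathcal{T}$ an index set (or class), $X_{\mathcal{T}}=\{(X_s,d_s)\}_{s\in\mathcal{T}}$ pseudometric spaces and $f_{\mathcal{T}}=\{f_s:X_s\to Y\}_{s\in\mathcal{T}}$ functions; $\mathrm{im}(f_{\mathcal{T}})=\bigcup_s\mathrm{im}(f_s)$. A pseudometric $d$ on $Y$ is $\mathcal{R}$-stable if $d(f_s(x_1),f_s(x_2))\le d_s(x_1,x_2)$ for all $s\in\mathcal{T}$, $x_1,x_2\in X_s$. It is $\mathcal{R}$-optimal if it is $\mathcal{R}$-stable and every $\mathcal{R}$-stable pseudometric $d'$ on $Y$ satisfies $d'(y_1,y_2)\le d(y_1,y_2)$ for all $y_1,y_2\in\mathrm{im}(f_{\mathcal{T}})$. $\mathcal{R}_{1}$ is the relative structure on the isomorphism classes of $B_n$-persistence modules in which $\mathcal{T}$ consists of all pairs $(T,i)$ with $T$ a topological space and $i\in\mathbb{Z}_{\ge0}$, $X_{(T,i)}$ is the set of pairs $(T,g)$ with $g:T\to\mathbb{R}^n$ a function, $d_{(T,i)}((T,g_1),(T,g_2))=\sup_{x\in T}\|g_1(x)-g_2(x)\|_\infty$, and $f_{(T,i)}(T,g)$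 is the class of $H_i\circ F^S(T,g)$. *)

(* Defs.v *)
From HB Require Import structures.
From mathcomp Require Import all_boot all_order all_algebra.
From mathcomp Require Import finmap.
From mathcomp Require Import all_classical all_reals interval_inference.
From mathcomp Require Import ereal topology normedtype.
(* The notations of [monalg] clash with those of the analysis library. *)
From mathcomp.multinomials Require Import -(notations) monalg.
Import Order.TTheory GRing.Theory Num.Theory.
Import numFieldNormedType.Exports.

Set Implicit Arguments.
Unset Strict Implicit.
Unset Printing Implicit Defensive.

Local Open Scope classical_set_scope.
Local Open Scope ring_scope.

Section MonoidRing.
Variables (R : realType) (n : nat).

(* The additive monoid R_{>=0}^n; [monomType] uses multiplicative notation. *)
Record nnvec := NNVec {
  nnval :> 'rV[R]_n;
  nnvalP : [forall i, 0 <= nnval ord0 i] }.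

HB.instance Definition _ := [isSub for nnval].
HB.instance Definition _ := [Choice of nnvec by <:].

Lemma nnvec_ge0 (v : nnvec) i : 0 <= nnval v ord0 i.
Proof. exact: (forallP (nnvalP v)). Qed.

Lemma nnvec0P : [forall i, 0 <= (0 : 'rV[R]_n) ord0 i].
Proof. by apply/forallP => i; rewrite mxE. Qed.
Definition nnvec0 := NNVec nnvec0P.

Lemma nnvec_addP (u v : nnvec) :
  [forall i, 0 <= (nnval u + nnval v) ord0 i].
Proof. by apply/forallP => i; rewrite mxE addr_ge0 ?nnvec_ge0. Qed.
Definition nnvec_add (u v : nnvec) := NNVec (nnvec_addP u v).

Lemma nnvec_addA : associative nnvec_add.
Proof. by move=> u v w; apply/val_inj; rewrite /= addrA. Qed.
Lemma nnvec_addC : commutative nnvec_add.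
Proof. by move=> u v; apply/val_inj; rewrite /= addrC. Qed.
Lemma nnvec_add0 : left_id nnvec0 nnvec_add.
Proof. by move=> u; apply/val_inj; rewrite /= add0r. Qed.
Lemma nnvec_addr0 : right_id nnvec0 nnvec_add.
Proof. by move=> u; apply/val_inj; rewrite /= addr0. Qed.
Lemma nnvec_conical u v :
  nnvec_add u v = nnvec0 -> u = nnvec0 /\ v = nnvec0.
Proof.
move=> /(congr1 nnval) /= /rowP e.
have h i : nnval u ord0 i = 0 /\ nnval v ord0 i = 0.
  have := e i; rewrite !mxE => /eqP.
  by rewrite paddr_eq0 ?nnvec_ge0 // => /andP[/eqP -> /eqP ->].
by split; apply/val_inj/rowP => i /=; rewrite mxE; case: (h i).
Qed.

HB.instance Definition _ := Choice_isMonomialDef.Build nnvec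
  nnvec_addA nnvec_add0 nnvec_addr0 nnvec_conical.
HB.instance Definition _ := MonomialDef_isConomialDef.Build nnvec nnvec_addC.

Lemma nnaxisP (i : 'I_n) (t : {nonneg R}) :
  [forall j, 0 <= (t%:num *: delta_mx ord0 i : 'rV[R]_n) ord0 j].
Proof. by apply/forallP => j; rewrite !mxE mulr_ge0 // ler0n. Qed.
Definition nnaxis i t := NNVec (nnaxisP i t).

Lemma nndiagP (t : {nonneg R}) :
  [forall j, 0 <= (const_mx t%:num : 'rV[R]_n) ord0 j].
Proof. by apply/forallP => j; rewrite mxE. Qed.
Definition nndiag t := NNVec (nndiagP t).

Definition lev (a b : 'rV[R]_n) : bool := [forall i, a ord0 i <= b ord0 i].

Lemma levv a : lev a a.
Proof. exact/forallP. Qed.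

Lemma lev_trans b a c : lev a b -> lev b c -> lev a c.
Proof.
by move=> /forallP h1 /forallP h2; apply/forallP => i; apply: le_trans (h2 i).
Qed.

Lemma nnsubP a b : lev a b -> [forall i, 0 <= (b - a) ord0 i].
Proof.
by move=> /forallP h; apply/forallP => i; rewrite !mxE subr_ge0; apply: h.
Qed.
Definition nnsub a b (h : lev a b) := NNVec (nnsubP h).

Lemma lev_subl (c : nnvec) a : lev (a - nnval c) a.
Proof. by apply/forallP => i; rewrite !mxE lerBlDr lerDl nnvec_ge0. Qed.

Lemma lev_diag (e : {nonneg R}) a : lev a (a + const_mx e%:num).
Proof. by apply/forallP => i; rewrite !mxE lerDl. Qed.

End MonoidRing.

(* [monoid_ring k R n] is k[R_{>=0}^n]; [xpow u] is x_1^{u_1} ... x_n^{u_n}. *)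
Definition monoid_ring (k : fieldType) (R : realType) (n : nat) :
  comNzRingType := malg (nnvec R n) k.

Definition xpow (k : fieldType) (R : realType) (n : nat) (u : nnvec R n) :
  monoid_ring k R n := mkmalgU u 1.

Lemma xpow0 (k : fieldType) (R : realType) (n : nat) :
  xpow k (nnvec0 R n) = 1.
Proof. by []. Qed.

Lemma xpowD (k : fieldType) (R : realType) (n : nat) (u v : nnvec R n) :
  xpow k (nnvec_add u v) = xpow k u * xpow k v.
Proof. by rewrite /xpow malgM_def fgmulUU mulr1. Qed.

Section MalgLift.
Variables (k : fieldType) (K : choiceType) (W : lmodType k) (f : K -> W).

(* The linear extension of [f]. *)
Definition malg_lift (g : malg K k) : W :=
  \sum_(x <- msupp g) mcoeff x g *: f x.

Lemma malg_liftw (d : {fset K}) (g : malg K k) :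
  (msupp g `<=` d)%fset -> malg_lift g = \sum_(x <- d) mcoeff x g *: f x.
Proof.
move=> le; rewrite /malg_lift (big_fset_incl _ le) //=.
by move=> x _ /mcoeff_outdom ->; rewrite scale0r.
Qed.

Lemma malg_lift_is_linear : linear malg_lift.
Proof.
move=> c g h; pose d := (msupp g `|` msupp h `|` msupp (c *: g + h))%fset.
have hg : (msupp g `<=` d)%fset by apply/fsubsetP => x; rewrite !inE => ->.
have hh : (msupp h `<=` d)%fset.
  by apply/fsubsetP => x; rewrite !inE => ->; rewrite orbT.
rewrite (malg_liftw hg) (malg_liftw hh) (@malg_liftw d) ?fsubsetUr //.
rewrite scaler_sumr -big_split /=; apply: eq_bigr => x _.
by rewrite mcoeffD mcoeffZ scalerDl scalerA.
Qed.
HB.instance Definition _ := GRing.isLinear.Build k (malg K k) W *:%R malg_lift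
  malg_lift_is_linear.

Lemma malg_liftU c x : malg_lift (mkmalgU x c) = c *: f x.
Proof. by rewrite (malg_liftw msuppU_le) big_seq_fset1 mcoeffUU. Qed.

End MalgLift.

Lemma mkmalgUZ (k : fieldType) (K : choiceType) (x : K) (c : k) :
  mkmalgU x c = c *: mkmalgU x 1.
Proof. by apply/malgP => y; rewrite mcoeffZ !mcoeffU mulrnAr mulr1. Qed.

Lemma malg_linear_ext (k : fieldType) (K : choiceType) (W : lmodType k)
    (f g : {linear malg K k -> W}) :
  (forall x, f (mkmalgU x 1) = g (mkmalgU x 1)) -> f =1 g.
Proof.
move=> fg z; rewrite (monalgE z) !linear_sum; apply: eq_bigr => x _.
by rewrite mkmalgUZ !linearZ fg.
Qed.

(* A linear action of a monoid [K] on a k-vector space [W] makes [W] a module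
   over the monoid ring k[K]. *)
Section MonoidRingModule.
Variables (k : fieldType) (K : monomType).

Record linear_action (W : lmodType k) := LinearAction {
  la_fun :> K -> {linear W -> W};
  la_one : forall w, la_fun (@mone K) w = w;
  la_mul : forall x y w, la_fun (@mmul K x y) w = la_fun x (la_fun y w) }.

Variables (W : lmodType k) (act : linear_action W).

Definition action_module of linear_action W : Type := W.
Local Notation Wm := (action_module act).

HB.instance Definition _ := GRing.Zmodule.on Wm.

Definition action_scale (b : malg K k) (w : Wm) : Wm :=
  malg_lift (fun x => act x w : W) b.

Lemma action_scaleD b : {morph action_scale b : u v / u + v}.
Proof.
move=> u v; rewrite /action_scale /malg_lift -big_split /=.
by apply: eq_bigr => x _; rewrite linearD scalerDr.
Qed.

Lemma action_scaleDl w : {morph action_scale^~ w : b c / b + c}.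
Proof. by move=> b c; rewrite /action_scale linearD. Qed.

Lemma action_scale1 : left_id 1 action_scale.
Proof. by move=> w; rewrite /action_scale malg_liftU scale1r la_one. Qed.

Lemma action_scaleA b c w :
  action_scale b (action_scale c w) = action_scale (b * c) w.
Proof.
rewrite /action_scale malgME linear_sum [in LHS]/malg_lift.
apply: eq_bigr => x _; rewrite linear_sum scaler_sumr [in RHS]linear_sum.
by apply: eq_bigr => y _ /=; rewrite malg_liftU la_mul linearZ scalerA.
Qed.

HB.instance Definition _ := GRing.Zmodule_isLmodule.Build (malg K k) Wm
  action_scaleA action_scale1 action_scaleD action_scaleDl.

Lemma action_moduleU x (w : Wm) : mkmalgU x 1 *: w = act x w.
Proof.
by rewrite /GRing.scale /= /action_scale malg_liftU scale1r.
Qed.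

Lemma action_moduleC c (w : Wm) :
  (mkmalgU (@mone K) c : malg K k) *: w = (c *: (w : W)).
Proof. by rewrite /GRing.scale /= /action_scale malg_liftU la_one. Qed.

End MonoidRingModule.

Section DirectSum.
Variables (k : fieldType) (I : choiceType) (V : I -> lmodType k).

Record dsum := DSum {
  dsfun :> forall i, V i;
  dsfinP : exists s : seq I, forall i, i \notin s -> dsfun i = 0 }.

HB.instance Definition _ := gen_eqMixin dsum.
HB.instance Definition _ := gen_choiceMixin dsum.

Lemma dsumP (u v : dsum) : (forall i, u i = v i) <-> u = v.
Proof.
split=> [|-> //]; case: u v => u hu [v hv] /= e.
have euv : u = v by apply: functional_extensionality_dep.
by case: _ / euv hv => hv; congr DSum; apply: Prop_irrelevance.
Qed.

Lemma dsum0P : exists s : seq I, forall i, i \notin s -> (0 : V i) = 0.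
Proof. by exists [::]. Qed.
Definition dsum0 := DSum dsum0P.

Lemma dsum_oppP (u : dsum) :
  exists s : seq I, forall i, i \notin s -> - u i = 0.
Proof. by case: u => u [s hs]; exists s => i /hs /= ->; rewrite oppr0. Qed.
Definition dsum_opp u := DSum (dsum_oppP u).

Lemma dsum_addP (u v : dsum) :
  exists s : seq I, forall i, i \notin s -> u i + v i = 0.
Proof.
case: u v => u [s hs] [v [t ht]]; exists (s ++ t) => i /=.
by rewrite mem_cat negb_or => /andP[/hs -> /ht ->]; rewrite addr0.
Qed.
Definition dsum_add u v := DSum (dsum_addP u v).

Lemma dsum_scaleP (c : k) (u : dsum) :
  exists s : seq I, forall i, i \notin s -> c *: u i = 0.
Proof. by case: u => u [s hs]; exists s => i /hs /= ->; rewrite scaler0. Qed.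
Definition dsum_scale c u := DSum (dsum_scaleP c u).

Lemma dsum_addA : associative dsum_add.
Proof. by move=> u v w; apply/dsumP => i; rewrite /= addrA. Qed.
Lemma dsum_addC : commutative dsum_add.
Proof. by move=> u v; apply/dsumP => i; rewrite /= addrC. Qed.
Lemma dsum_add0 : left_id dsum0 dsum_add.
Proof. by move=> u; apply/dsumP => i; rewrite /= add0r. Qed.
Lemma dsum_addN : left_inverse dsum0 dsum_opp dsum_add.
Proof. by move=> u; apply/dsumP => i; rewrite /= addNr. Qed.
HB.instance Definition _ := GRing.isZmodule.Build dsum
  dsum_addA dsum_addC dsum_add0 dsum_addN.

Lemma dsum_scaleA c d u : dsum_scale c (dsum_scale d u) = dsum_scale (c * d) u.
Proof. by apply/dsumP => i; rewrite /= scalerA. Qed.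
Lemma dsum_scale1 : left_id 1 dsum_scale.
Proof. by move=> u; apply/dsumP => i; rewrite /= scale1r. Qed.
Lemma dsum_scaleDr : right_distributive dsum_scale +%R.
Proof. by move=> c u v; apply/dsumP => i; rewrite /= scalerDr. Qed.
Lemma dsum_scaleDl u : {morph dsum_scale^~ u : c d / c + d}.
Proof. by move=> c d; apply/dsumP => i; rewrite /= scalerDl. Qed.
HB.instance Definition _ := GRing.Zmodule_isLmodule.Build k dsum
  dsum_scaleA dsum_scale1 dsum_scaleDr dsum_scaleDl.

Lemma dsumD (u v : dsum) i : (u + v) i = u i + v i. Proof. by []. Qed.
Lemma dsumZ c (u : dsum) i : (c *: u) i = c *: u i. Proof. by []. Qed.

Lemma dsum_sum (s : seq I) (h : I -> dsum) i :
  (\sum_(j <- s) h j) i = \sum_(j <- s) h j i.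
Proof.
by elim: s => [|a s ih]; rewrite ?big_nil // !big_cons dsumD ih.
Qed.

End DirectSum.

Section PersistenceModules.
Variables (k : fieldType) (R : realType) (n : nat).
Local Notation B := (monoid_ring k R n).
Local Notation x_ i t := (xpow k (nnaxis i t)).
Local Notation "c %:B" := (mkmalgU (nnvec0 R n) c : B) (at level 2).

(* k acts on [pm_car] through the constants of k[R_{>=0}^n].  [pm_dec] and
   [pm_ind] say that [pm_car] is the internal direct sum of the
   k-subspaces [pm_gr a]. *)
Record pmodule := PModule {
  pm_car :> lmodType B;
  pm_gr : 'rV[R]_n -> set pm_car;
  pm_gr0 : forall a, pm_gr a 0;
  pm_grD : forall a u v, pm_gr a u -> pm_gr a v -> pm_gr a (u + v);
  pm_grZ : forall a (c : k) u, pm_gr a u -> pm_gr a (c%:B *: u);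
  pm_dec : forall u, exists (s : seq 'rV[R]_n) (h : 'rV[R]_n -> pm_car),
    (forall a, pm_gr a (h a)) /\ u = \sum_(a <- s) h a;
  pm_ind : forall (s : seq 'rV[R]_n) (h : 'rV[R]_n -> pm_car), uniq s ->
    (forall a, pm_gr a (h a)) -> \sum_(a <- s) h a = 0 ->
    forall a, a \in s -> h a = 0;
  pm_act : forall a i (t : {nonneg R}) u, pm_gr a u ->
    pm_gr (a + t%:num *: delta_mx ord0 i) (x_ i t *: u) }.

Record pm_hom (M N : pmodule) := PMHom {
  pmh_fun :> {linear M -> N};
  pmh_gr : forall a u, pm_gr a u -> pm_gr a (pmh_fun u) }.

Definition transition (M : pmodule) (a b : 'rV[R]_n) (h : lev a b) (u : M) :
    M :=
  xpow k (nnsub h) *: u.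

Lemma nnvec_axes (u : nnvec R n) :
  u = \big[@nnvec_add R n/nnvec0 R n]_(i < n)
        nnaxis i (NngNum (nnvec_ge0 u i)).
Proof.
apply/val_inj; rewrite /= (big_morph (@nnval R n) (op1 := +%R) (id1 := 0)) //.
by rewrite [LHS]row_sum_delta.
Qed.

Lemma pm_act_xpow (M : pmodule) (u : nnvec R n) a (m : M) :
  pm_gr a m -> pm_gr (a + nnval u) (xpow k u *: m).
Proof.
rewrite [u]nnvec_axes; elim: (index_enum _) a m => [|i s ih] a m hm.
  by rewrite big_nil xpow0 scale1r addr0.
rewrite big_cons xpowD /= addrA mulrC -scalerA.
apply: ih; exact: (pm_act i (NngNum (nnvec_ge0 u i)) hm).
Qed.

Lemma transition_gr (M : pmodule) a b (h : lev a b) (u : M) :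
  pm_gr a u -> pm_gr b (transition h u).
Proof. by move=> /(pm_act_xpow (nnsub h)); rewrite /= addrC subrK. Qed.

Section Shift.
Variables (M : pmodule) (e : R).
Local Notation "a +e" := (a + const_mx e) (at level 50).

Lemma shift_dec (u : M) : exists (s : seq 'rV[R]_n) (h : 'rV[R]_n -> M),
  (forall a, pm_gr (a +e) (h a)) /\ u = \sum_(a <- s) h a.
Proof.
have [s [h [hh ->]]] := pm_dec u.
exists [seq a - const_mx e | a <- s], (fun a => h (a +e)); split => //.
by rewrite big_map; apply: eq_bigr => a _; rewrite subrK.
Qed.

Lemma shift_ind (s : seq 'rV[R]_n) (h : 'rV[R]_n -> M) : uniq s ->
  (forall a, pm_gr (a +e) (h a)) -> \sum_(a <- s) h a = 0 ->
  forall a, a \in s -> h a = 0.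
Proof.
move=> us hh s0 a sa.
pose s' := [seq a +e | a <- s]; pose h' b := h (b - const_mx e).
have us' : uniq s' by rewrite map_inj_uniq // => b c /addIr.
have hh' b : pm_gr b (h' b) by have := hh (b - const_mx e); rewrite subrK.
have s0' : \sum_(b <- s') h' b = 0.
  by rewrite big_map -[RHS]s0; apply: eq_bigr => b _; rewrite /h' addrK.
by have := pm_ind us' hh' s0' (map_f _ sa); rewrite /h' addrK.
Qed.

Lemma shift_act a i (t : {nonneg R}) (u : M) : pm_gr (a +e) u ->
  pm_gr ((a + t%:num *: delta_mx ord0 i) +e) (x_ i t *: u).
Proof. by rewrite addrAC; apply: pm_act. Qed.

Definition shift : pmodule := PModule
  (fun a => @pm_gr0 M (a +e))
  (fun a => @pm_grD M (a +e))
  (fun a => @pm_grZ M (a +e))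
  shift_dec shift_ind shift_act.

End Shift.

Definition shift_hom (M N : pmodule) (e : R) (f : pm_hom M N) :
    pm_hom (shift M e) (shift N e) :=
  @PMHom (shift M e) (shift N e) (pmh_fun f)
    (fun a => @pmh_gr M N f (a + const_mx e)).

Section Smoothing.
Variables (M : pmodule) (e : {nonneg R}).

Definition smoothing_fun (u : M) : shift M e%:num := xpow k (nndiag n e) *: u.

Lemma smoothing_is_linear : linear smoothing_fun.
Proof.
move=> c u v; rewrite /smoothing_fun scalerDr !scalerA.
by rewrite mulrC.
Qed.
HB.instance Definition _ := GRing.isLinear.Build B M (shift M e%:num) *:%R
  smoothing_fun smoothing_is_linear.

Lemma smoothing_gr a (u : M) :
  pm_gr a u -> @pm_gr (shift M e%:num) a (smoothing_fun u).
Proof. exact: (@pm_act_xpow M (nndiag n e)). Qed.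

(* On the summand of degree [a] this is [transition] from [a] to [a + e], and
   the power of x by which it multiplies does not depend on [a]. *)
Definition smoothing : pm_hom M (shift M e%:num) :=
  @PMHom M (shift M e%:num) smoothing_fun smoothing_gr.

Lemma smoothingE a (u : M) : smoothing u = transition (lev_diag e a) u.
Proof.
rewrite /= /smoothing_fun /transition; congr (xpow k _ *: u).
by apply/val_inj; rewrite /= addrC addKr.
Qed.

End Smoothing.

Definition interleaved (e : {nonneg R}) (M N : pmodule) : Prop :=
  exists (f : pm_hom M (shift N e%:num)) (g : pm_hom N (shift M e%:num)),
    (forall u : M, shift_hom e%:num g (f u) =
                   smoothing M (2 * e%:num)%:nng u :> M) /\
    (forall v : N, shift_hom e%:num f (g v) =
                   smoothing N (2 * e%:num)%:nng v :> N).

Definition dI (M N : pmodule) : \bar R :=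
  ereal_inf [set (e%:num)%:E | e in [set e : {nonneg R} | interleaved e M N]].

Definition pm_iso (M N : pmodule) : Prop :=
  exists (f : pm_hom M N) (g : pm_hom N M), cancel f g /\ cancel g f.

Lemma pm_iso_refl M : pm_iso M M.
Proof.
pose f := @PMHom M M idfun (fun _ _ => id).
by exists f, f.
Qed.

Lemma pm_iso_sym M N : pm_iso M N -> pm_iso N M.
Proof. by move=> [f [g [h1 h2]]]; exists g, f. Qed.

Definition pm_comp (M N P : pmodule) (g : pm_hom N P) (f : pm_hom M N) :
  pm_hom M P :=
  @PMHom M P (pmh_fun g \o pmh_fun f)
    (fun a u h => pmh_gr g (pmh_gr f h)).

Lemma pm_iso_trans N M P : pm_iso M N -> pm_iso N P -> pm_iso M P.
Proof.
move=> [f [g [fg gf]]] [f' [g' [fg' gf']]].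
exists (pm_comp f' f), (pm_comp g g').
by split=> u /=; rewrite ?fg' ?fg ?gf ?gf'.
Qed.

Lemma interleaved_iso e M M' N N' :
  pm_iso M M' -> pm_iso N N' -> interleaved e M N -> interleaved e M' N'.
Proof.
move=> [p [p' [pK p'K]]] [q [q' [qK q'K]]] [f [g [gf fg]]].
exists (pm_comp (shift_hom e%:num q) (pm_comp f p')).
exists (pm_comp (shift_hom e%:num p) (pm_comp g q')).
split=> u /=; rewrite ?qK ?pK.
- by have /= -> := gf (p' u); rewrite /smoothing_fun linearZ /= p'K.
- by have /= -> := fg (q' u); rewrite /smoothing_fun linearZ /= q'K.
Qed.

Lemma dI_iso M M' N N' : pm_iso M M' -> pm_iso N N' -> dI M N = dI M' N'.
Proof.
move=> hM hN; rewrite /dI; congr (ereal_inf (image _ _)).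
apply/seteqP; split=> e /=; apply: interleaved_iso => //; exact: pm_iso_sym.
Qed.

(* An isomorphism class is represented by its membership predicate. *)
Record isoclass := IsoClass {
  ic_mem :> pmodule -> Prop;
  ic_ex : exists M, ic_mem = pm_iso M }.

Definition class_of (M : pmodule) : isoclass :=
  IsoClass (ex_intro (fun N => pm_iso M = pm_iso N) M erefl).

Lemma class_ofP M N : class_of M = class_of N <-> pm_iso M N.
Proof.
split=> [/(congr1 ic_mem) /= -> | h]; first exact: pm_iso_refl.
have e : pm_iso M = pm_iso N.
  apply/funext => P; apply/propext; split; apply: pm_iso_trans => //.
  exact: pm_iso_sym.
by rewrite /class_of; move: (ex_intro _ N _); rewrite -e => q; congr IsoClass;
  exact: Prop_irrelevance.
Qed.

Definition class_repr (C : isoclass) : pmodule := projT1 (cid (ic_ex C)).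

Lemma class_reprP M : pm_iso (class_repr (class_of M)) M.
Proof.
rewrite /class_repr; case: cid => N /= e.
by rewrite -e; exact: pm_iso_refl.
Qed.

Definition dI_class (C D : isoclass) : \bar R :=
  dI (class_repr C) (class_repr D).

Lemma dI_classE M N : dI_class (class_of M) (class_of N) = dI M N.
Proof. by apply: dI_iso; apply: class_reprP. Qed.

End PersistenceModules.

(* A functor from the poset R^n to k-vector spaces. *)
Record diagram (k : fieldType) (R : realType) (n : nat) := Diagram {
  dg_obj :> 'rV[R]_n -> lmodType k;
  dg_map : forall a b, lev a b -> {linear dg_obj a -> dg_obj b};
  dg_id : forall a (h : lev a a) u, dg_map h u = u;
  dg_comp : forall a b c (hab : lev a b) (hbc : lev b c) (hac : lev a c) u,
    dg_map hbc (dg_map hab u) = dg_map hac u }.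

Section ModuleOfDiagram.
Variables (k : fieldType) (R : realType) (n : nat) (V : diagram k R n).
Local Notation W := (dsum V).

Definition dg_shift_fun (c : nnvec R n) (u : W) a : V a :=
  dg_map V (lev_subl c a) (u (a - nnval c)).

Lemma dg_shiftP c (u : W) : exists s : seq 'rV[R]_n,
  forall a, a \notin s -> dg_shift_fun c u a = 0.
Proof.
have [s hs] := dsfinP u; exists [seq b + nnval c | b <- s] => a ha.
rewrite /dg_shift_fun hs ?linear0 //; apply: contra ha => ha.
by apply/mapP; exists (a - nnval c); rewrite ?subrK.
Qed.

Definition dg_shift c (u : W) : W := DSum (dg_shiftP c u).

Lemma dg_shift_is_linear c : linear (dg_shift c).
Proof.
move=> d u v; apply/dsumP => a.
by rewrite /= /dg_shift_fun dsumD dsumZ linearP.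
Qed.
HB.instance Definition _ c := GRing.isLinear.Build k W W *:%R (dg_shift c)
  (dg_shift_is_linear c).

Lemma dg_map_eq a a' b (e : a = a') (h : lev a b) (h' : lev a' b) (u : W) :
  dg_map V h (u a) = dg_map V h' (u a').
Proof. by case: _ / e h' => h'; rewrite (Prop_irrelevance h h'). Qed.

Lemma dg_shift0 u : dg_shift (nnvec0 R n) u = u.
Proof.
apply/dsumP => a; rewrite /= /dg_shift_fun.
by rewrite (dg_map_eq (subr0 a) _ (levv a)) dg_id.
Qed.

Lemma dg_shiftD c d u :
  dg_shift (nnvec_add c d) u = dg_shift c (dg_shift d u).
Proof.
apply/dsumP => a; rewrite /= /dg_shift_fun /=.
have e : a - (nnval c + nnval d) = a - nnval c - nnval d.
  by rewrite opprD addrA.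
have h : lev (a - nnval c - nnval d) a.
  by apply: lev_trans (lev_subl c a); apply: lev_subl.
by rewrite (dg_map_eq e _ h) (dg_comp _ _ h).
Qed.

Definition dg_action : linear_action (nnvec R n) W :=
  @LinearAction k (nnvec R n) W dg_shift dg_shift0 dg_shiftD.

(* The direct sum of the spaces [V a], on which x^c acts by the maps
   V_a -> V_{a + c}. *)
Definition dg_car : lmodType (monoid_ring k R n) := action_module dg_action.

Definition dg_gr (a : 'rV[R]_n) : set dg_car :=
  [set u | forall b, b != a -> (u : W) b = 0].

Lemma dg_gr0 a : dg_gr a 0.
Proof. by []. Qed.

Lemma dg_grD a u v : dg_gr a u -> dg_gr a v -> dg_gr a (u + v).
Proof.
by move=> hu hv b ba; rewrite (@dsumD k _ V u v) (hu _ ba) (hv _ ba) addr0.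
Qed.

Lemma dg_grZ a (c : k) u :
  dg_gr a u -> dg_gr a ((mkmalgU (nnvec0 R n) c : monoid_ring k R n) *: u).
Proof.
by move=> hu b ba; rewrite (action_moduleC c) dsumZ (hu _ ba) scaler0.
Qed.

Lemma dg_restrP a (u : W) : exists s : seq 'rV[R]_n, forall b, b \notin s ->
  (if b == a then u b else 0) = 0.
Proof. by have [s hs] := dsfinP u; exists s => b /hs ->; case: eqP. Qed.
Definition dg_restr a (u : W) : dg_car := DSum (dg_restrP a u).

Lemma dg_car_sum (s : seq 'rV[R]_n) (h : 'rV[R]_n -> dg_car) b :
  (\sum_(a <- s) h a : W) b = \sum_(a <- s) (h a : W) b.
Proof. exact: (@dsum_sum k _ V s h b). Qed.

Lemma dg_dec (u : dg_car) :
  exists (s : seq 'rV[R]_n) (h : 'rV[R]_n -> dg_car),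
    (forall a, dg_gr a (h a)) /\ u = \sum_(a <- s) h a.
Proof.
have [s hs] := dsfinP u; exists (undup s), (fun a => dg_restr a u); split.
  by move=> a b /negbTE /= ->.
apply/dsumP => b; rewrite dg_car_sum /=.
have [bs|bs] := boolP (b \in undup s).
  rewrite (bigD1_seq b) ?undup_uniq //= eqxx big1 ?addr0 // => a.
  by rewrite eq_sym => /negbTE ->.
rewrite big1_seq => [|a /andP[_ sa]]; first by rewrite hs // -mem_undup.
by case: eqP => // e; rewrite e sa in bs.
Qed.

Lemma dg_ind (s : seq 'rV[R]_n) (h : 'rV[R]_n -> dg_car) : uniq s ->
  (forall a, dg_gr a (h a)) -> \sum_(a <- s) h a = 0 ->
  forall a, a \in s -> h a = 0.
Proof.
move=> us hh s0 a sa; apply/dsumP => b.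
have [->{b}|ba] := eqVneq b a; last exact: hh.
have := dg_car_sum s h a; rewrite s0 (bigD1_seq a) //= big1 ?addr0.
  by move=> <-.
by move=> b ba; apply: hh; rewrite eq_sym.
Qed.

Lemma dg_act a i (t : {nonneg R}) (u : dg_car) : dg_gr a u ->
  dg_gr (a + t%:num *: delta_mx ord0 i) (xpow k (nnaxis i t) *: u).
Proof.
move=> hu b hb; rewrite (action_moduleU (nnaxis i t)) /= /dg_shift_fun hu.
  by rewrite linear0.
by apply: contra hb => /eqP <-; rewrite subrK.
Qed.

Definition module_of_diagram : pmodule k R n :=
  PModule dg_gr0 dg_grD dg_grZ dg_dec dg_ind dg_act.

Lemma module_of_diagram_transition a b (h : lev a b) (u : module_of_diagram) :
  (transition h u : W) b = dg_map V h ((u : W) a).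
Proof.
rewrite /transition (action_moduleU (nnsub h)) /= /dg_shift_fun /=.
by apply: dg_map_eq; rewrite opprB addrC subrK.
Qed.

End ModuleOfDiagram.

Section LmodQuotient.
Local Open Scope quotient_scope.
Variables (k : fieldType) (V : lmodType k) (I : submodClosed V).

Definition submod_pred : {pred V} := I.
Lemma submod_pred_zmod_closed : zmod_closed submod_pred.
Proof.
split; first exact: (@rpred0 V I).
by move=> u v hu hv; rewrite /submod_pred -scaleN1r rpredD // rpredZ.
Qed.
HB.instance Definition _ := GRing.isZmodClosed.Build V submod_pred
  submod_pred_zmod_closed.

Definition lmod_quot : Type := Quotient.quot submod_pred.
HB.instance Definition _ := GRing.Zmodule.on lmod_quot.

Definition lmod_pi (u : V) : lmod_quot := \pi_(Quotient.quot submod_pred) u.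

Lemma lmod_piP u v : lmod_pi u = lmod_pi v <-> u - v \in I.
Proof.
rewrite -[u - v \in I]/(u - v \in submod_pred) Quotient.idealrBE.
by split=> [/eqP|/eqP].
Qed.

Lemma lmod_pi_ind (P : lmod_quot -> Prop) :
  (forall u, P (lmod_pi u)) -> forall q, P q.
Proof. by move=> h q; rewrite -[q]reprK; apply: h. Qed.

Lemma lmod_piD : {morph lmod_pi : u v / u + v}.
Proof. by move=> u v; rewrite /lmod_pi piE. Qed.

Definition lmod_quot_scale (c : k) (q : lmod_quot) : lmod_quot :=
  lmod_pi (c *: repr q).

Lemma lmod_quot_scale_pi c u : lmod_quot_scale c (lmod_pi u) = lmod_pi (c *: u).
Proof.
by apply/lmod_piP; rewrite -scalerBr rpredZ //; apply/lmod_piP; exact: reprK.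
Qed.

Lemma lmod_quot_scaleA c d q :
  lmod_quot_scale c (lmod_quot_scale d q) = lmod_quot_scale (c * d) q.
Proof.
by elim/lmod_pi_ind: q => u; rewrite !lmod_quot_scale_pi scalerA.
Qed.
Lemma lmod_quot_scale1 : left_id 1 lmod_quot_scale.
Proof. by elim/lmod_pi_ind => u; rewrite lmod_quot_scale_pi scale1r. Qed.
Lemma lmod_quot_scaleDr : right_distributive lmod_quot_scale +%R.
Proof.
move=> c; elim/lmod_pi_ind => u; elim/lmod_pi_ind => v.
by rewrite -lmod_piD !lmod_quot_scale_pi scalerDr lmod_piD.
Qed.
Lemma lmod_quot_scaleDl q : {morph lmod_quot_scale^~ q : c d / c + d}.
Proof.
elim/lmod_pi_ind: q => u c d.
by rewrite !lmod_quot_scale_pi scalerDl lmod_piD.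
Qed.
HB.instance Definition _ := GRing.Zmodule_isLmodule.Build k lmod_quot
  lmod_quot_scaleA lmod_quot_scale1 lmod_quot_scaleDr lmod_quot_scaleDl.

Lemma lmod_pi_is_linear : linear lmod_pi.
Proof. by move=> c u v; rewrite lmod_piD -lmod_quot_scale_pi. Qed.
HB.instance Definition _ := GRing.isLinear.Build k V lmod_quot *:%R lmod_pi
  lmod_pi_is_linear.

End LmodQuotient.

Section LmodQuotientMap.
Variables (k : fieldType) (V W : lmodType k).
Variables (I : submodClosed V) (J : submodClosed W) (f : {linear V -> W}).

Definition lmod_quot_map of (forall u, u \in I -> f u \in J) :=
  fun q : lmod_quot I => lmod_pi J
    (f (repr (q : Quotient.quot (submod_pred I)))).

Hypothesis fIJ : forall u, u \in I -> f u \in J.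

Lemma lmod_quot_map_pi u : lmod_quot_map fIJ (lmod_pi I u) = lmod_pi J (f u).
Proof.
by apply/lmod_piP; rewrite -linearB fIJ //; apply/lmod_piP; exact: reprK.
Qed.

Lemma lmod_quot_map_is_linear : linear (lmod_quot_map fIJ).
Proof.
move=> c; elim/lmod_pi_ind => u; elim/lmod_pi_ind => v.
by rewrite -linearP !lmod_quot_map_pi !linearP.
Qed.
HB.instance Definition _ := GRing.isLinear.Build k (lmod_quot I) (lmod_quot J)
  *:%R (lmod_quot_map fIJ) lmod_quot_map_is_linear.

End LmodQuotientMap.

Section StandardSimplex.
Variable R : realType.

Definition simplex_set (m : nat) : set 'rV[R]_m.+1 :=
  [set x | (forall j, 0 <= x ord0 j) /\ \sum_j x ord0 j = 1].

Arguments simplex_set : clear implicits.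

Definition simplex (m : nat) : topologicalType := set_type (simplex_set m).

Variables (m : nat) (j : 'I_m.+2).

Definition face_row (x : 'rV[R]_m.+1) : 'rV[R]_m.+2 :=
  \row_l oapp (x ord0) 0 (unlift j l).

Lemma face_row_lift x l : face_row x ord0 (lift j l) = x ord0 l.
Proof. by rewrite mxE liftK. Qed.

Lemma face_row_diag x : face_row x ord0 j = 0.
Proof. by rewrite mxE unlift_none. Qed.

Lemma face_rowP (x : simplex m) : face_row (val x) \in simplex_set m.+1.
Proof.
have [x0 x1] := set_valP x; apply/mem_set; split=> [l|].
  by rewrite mxE; case: unliftP => [l' _|_] //=; exact: x0.
rewrite (bigD1_ord j) //= face_row_diag add0r -[RHS]x1.
by apply: eq_bigr => l _; rewrite face_row_lift.
Qed.

Definition face_fun (x : simplex m) : simplex m.+1 :=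
  exist (fun y => is_true (y \in simplex_set m.+1)) _ (face_rowP x).

Lemma face_row_continuous : continuous face_row.
Proof.
move=> x A [P Px PA].
have h l : nbhs x [set y | P ord0 l (face_row y ord0 l)].
  have := Px ord0 l; rewrite mxE.
  case: (unliftP j l) => [l' e|e] /= hP.
    have hc : nbhs x [set y : 'rV[R]_m.+1 | P ord0 l (y ord0 l')].
      exact: (@coord_continuous R _ _ ord0 l' x _ hP).
    suff -> : [set y | P ord0 l (face_row y ord0 l)] =
      [set y : 'rV[R]_m.+1 | P ord0 l (y ord0 l')] by [].
    by apply/seteqP; split=> y /=; rewrite mxE e liftK.
  suff -> : [set y | P ord0 l (face_row y ord0 l)] = setT by exact: filterT.
  apply/seteqP; split=> y //= _; rewrite mxE e unlift_none /=.
  by rewrite -e; exact: nbhs_singleton hP.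
have FF : Filter (nbhs x) by exact: nbhs_filter.
have hall : nbhs x [set y | forall l, P ord0 l (face_row y ord0 l)].
  exact: (@filter_forall _ _ (fun l y => P ord0 l (face_row y ord0 l)) _ FF h).
apply: (@filterS _ _ FF _ _ _ hall) => y hy.
by apply: PA => i l; rewrite ord1.
Qed.

Lemma face_continuous : continuous face_fun.
Proof.
apply: continuous_comp_initial => x.
apply: (@continuous_comp _ _ _ set_val face_row).
  exact: initial_continuous.
exact: face_row_continuous.
Qed.

Definition face : continuousType (simplex m) (simplex m.+1) :=
  mkcts face_continuous.

End StandardSimplex.

Section SingularHomology.
Variables (k : fieldType) (R : realType).

Definition chain (X : topologicalType) (m : nat) : lmodType k :=
  malg (continuousType (simplex R m) X) k.

Definition singular_boundary (X : topologicalType) (m : nat)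
    (s : continuousType (simplex R m.+1) X) : chain X m :=
  \sum_(j < m.+2) (-1) ^+ j *:
    mkmalgU ((s \o face R j) : continuousType (simplex R m) X) 1.

Definition boundary (X : topologicalType) (m : nat) :
  {linear chain X m.+1 -> chain X m} := malg_lift (@singular_boundary X m).

Definition is_cycle (X : topologicalType) (m : nat) :
  chain X m -> Prop :=
  match m with
  | 0 => fun _ => True
  | m'.+1 => fun z => boundary X m' z = 0
  end.

Section Object.
Variables (X : topologicalType) (m : nat).

Definition cycle_pred : {pred chain X m} := fun z => `[< is_cycle z >].

Lemma cycle_submod_closed : GRing.submod_closed cycle_pred.
Proof.
rewrite /cycle_pred; split=> [|c u v]; rewrite !unfold_in.
  by apply/asboolP; case: (m) => [|m'] //; rewrite /is_cycle linear0.
move=> /asboolP hu /asboolP hv; apply/asboolP; move: u v hu hv.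
case: (m) => [|m'] u v //; rewrite /is_cycle => hu hv.
by rewrite linearP hu hv scaler0 addr0.
Qed.
HB.instance Definition _ := GRing.isSubmodClosed.Build k (chain X m) cycle_pred
  cycle_submod_closed.

Record cycle := Cycle {
  cycle_val :> chain X m;
  cycle_valP : cycle_val \in cycle_pred }.
HB.instance Definition _ := [isSub for cycle_val].
HB.instance Definition _ := [Choice of cycle by <:].
HB.instance Definition _ := [SubChoice_isSubLmodule of cycle by <:].

Definition bound_pred : {pred cycle} :=
  fun z => `[< exists c, cycle_val z = boundary X m c >].

Lemma bound_submod_closed : GRing.submod_closed bound_pred.
Proof.
rewrite /bound_pred; split=> [|c u v]; rewrite !unfold_in.
  by apply/asboolP; exists 0; rewrite linear0.
move=> /asboolP[a ea] /asboolP[b eb]; apply/asboolP; exists (c *: a + b).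
by rewrite linearP -ea -eb.
Qed.
HB.instance Definition _ := GRing.isSubmodClosed.Build k cycle bound_pred
  bound_submod_closed.

Definition homology : lmodType k := lmod_quot bound_pred.

End Object.

Arguments cycle_pred : clear implicits.
Arguments bound_pred : clear implicits.

Section Map.
Variables (X Y : topologicalType) (f : continuousType X Y).

Definition chain_map (m : nat) : {linear chain X m -> chain Y m} :=
  malg_lift (fun s : continuousType (simplex R m) X =>
    mkmalgU ((f \o s) : continuousType (simplex R m) Y) 1 : chain Y m).

Lemma chain_mapU m (s : continuousType (simplex R m) X) c :
  chain_map m (mkmalgU s c) =
  c *: mkmalgU ((f \o s) : continuousType (simplex R m) Y) 1.
Proof. exact: malg_liftU. Qed.

Lemma chain_map_boundary m (z : chain X m.+1) :
  boundary Y m (chain_map m.+1 z) = chain_map m (boundary X m z).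
Proof.
move: z; apply: (malg_linear_ext
  (f := boundary Y m \o chain_map m.+1) (g := chain_map m \o boundary X m)).
move=> s /=; rewrite /boundary chain_mapU scale1r !malg_liftU !scale1r.
rewrite /singular_boundary linear_sum; apply: eq_bigr => j _.
rewrite linearZ /= chain_mapU scale1r; congr (_ *: mkmalgU _ _).
exact/continuousEP.
Qed.

Variable m : nat.

Lemma chain_map_is_cycle (z : chain X m) :
  is_cycle z -> is_cycle (chain_map m z).
Proof.
move: z; case: (m) => [|m'] z //; rewrite /is_cycle => hz.
by rewrite chain_map_boundary hz linear0.
Qed.

Lemma chain_map_cycle (z : cycle X m) :
  chain_map m (cycle_val z) \in cycle_pred Y m.
Proof.
have := cycle_valP z; rewrite !unfold_in => /asboolP hz.
exact/asboolP/chain_map_is_cycle.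
Qed.

Definition cycle_map_fun (z : cycle X m) : cycle Y m :=
  Cycle (chain_map_cycle z).

Lemma cycle_map_is_linear : linear cycle_map_fun.
Proof. by move=> c u v; apply/val_inj; rewrite /= linearP. Qed.
HB.instance Definition _ := GRing.isLinear.Build k (cycle X m) (cycle Y m) *:%R
  cycle_map_fun cycle_map_is_linear.

Lemma cycle_map_bound (z : cycle X m) :
  z \in bound_pred X m -> cycle_map_fun z \in bound_pred Y m.
Proof.
rewrite !unfold_in => /asboolP[c e]; apply/asboolP; exists (chain_map m.+1 c).
by rewrite chain_map_boundary -e.
Qed.

Definition homology_map : {linear homology X m -> homology Y m} :=
  lmod_quot_map cycle_map_bound.

Lemma homology_map_pi z :
  homology_map (lmod_pi (bound_pred X m) z) =
  lmod_pi (bound_pred Y m) (cycle_map_fun z).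
Proof. exact: lmod_quot_map_pi. Qed.

End Map.

Lemma chain_map_id (X : topologicalType) (f : continuousType X X) m z :
  f =1 id -> chain_map f m z = z.
Proof.
move=> fE; move: z; apply: (malg_linear_ext (f := chain_map f m) (g := idfun)).
move=> s /=; rewrite chain_mapU scale1r; congr (mkmalgU _ _).
by apply/continuousEP => x /=; rewrite fE.
Qed.

Lemma homology_map_id (X : topologicalType) (f : continuousType X X) m u :
  f =1 id -> homology_map f m u = u.
Proof.
move=> fE; elim/lmod_pi_ind: u => z; rewrite homology_map_pi.
by congr (lmod_pi _ _); apply/val_inj; rewrite /= chain_map_id.
Qed.

Lemma homology_map_comp (X Y Z : topologicalType) (f : continuousType X Y)
    (g : continuousType Y Z) (h : continuousType X Z) m u :
  h =1 g \o f -> homology_map g m (homology_map f m u) = homology_map h m u.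
Proof.
move=> hE; elim/lmod_pi_ind: u => z; rewrite !homology_map_pi.
congr (lmod_pi _ _); apply/val_inj; case: z => z /= _; move: z.
apply: (malg_linear_ext (f := chain_map g m \o chain_map f m)
  (g := chain_map h m)) => s /=.
rewrite !chain_mapU !scale1r chain_mapU scale1r; congr (mkmalgU _ _).
by apply/continuousEP => x /=; rewrite hE.
Qed.

End SingularHomology.

Section SublevelFiltration.
Variables (k : fieldType) (R : realType) (n : nat).
Variables (T : topologicalType) (g : T -> 'rV[R]_n).

Definition sublevel_set (a : 'rV[R]_n) : set T := [set x | lev (g x) a].

(* [set_type] carries the subspace topology. *)
Definition sublevel (a : 'rV[R]_n) : topologicalType :=
  set_type (sublevel_set a).

Lemma sublevel_inclP a b (h : lev a b) (x : sublevel a) :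
  val x \in sublevel_set b.
Proof. apply/mem_set; exact: lev_trans (set_valP x) h. Qed.

Definition sublevel_incl_fun a b (h : lev a b) (x : sublevel a) : sublevel b :=
  exist (fun y => is_true (y \in sublevel_set b)) _ (sublevel_inclP h x).

Lemma sublevel_incl_continuous a b (h : lev a b) :
  continuous (sublevel_incl_fun h).
Proof. apply: continuous_comp_initial; exact: initial_continuous. Qed.

Definition sublevel_incl a b (h : lev a b) :
  continuousType (sublevel a) (sublevel b) :=
  mkcts (@sublevel_incl_continuous a b h).

Variable i : nat.

Lemma sublevel_diagram_id a (h : lev a a) u :
  homology_map k R (sublevel_incl h) i u = u.
Proof. by apply: homology_map_id => x; apply/val_inj. Qed.

Lemma sublevel_diagram_comp a b c (hab : lev a b) (hbc : lev b c)
    (hac : lev a c) u :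
  homology_map k R (sublevel_incl hbc) i
    (homology_map k R (sublevel_incl hab) i u) =
  homology_map k R (sublevel_incl hac) i u.
Proof. by apply: homology_map_comp => x; apply/val_inj. Qed.

Definition sublevel_diagram : diagram k R n :=
  Diagram sublevel_diagram_id sublevel_diagram_comp.

Definition sublevel_homology : pmodule k R n :=
  module_of_diagram sublevel_diagram.

End SublevelFiltration.

Local Open Scope ereal_scope.

Definition pseudometric (R : realType) (X : Type) (d : X -> X -> \bar R) :
    Prop :=
  [/\ forall x y, 0 <= d x y, forall x, d x x = 0,
      forall x y, d x y = d y x & forall x y z, d x z <= d x y + d y z].

Record relative_structure (R : realType) (Y : Type) := RelativeStructure {
  rs_index : Type;
  rs_space : rs_index -> Type;
  rs_dist : forall s, rs_space s -> rs_space s -> \bar R;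
  rs_distP : forall s, pseudometric (@rs_dist s);
  rs_map : forall s, rs_space s -> Y }.

Definition rs_im (R : realType) (Y : Type) (S : relative_structure R Y)
    (y : Y) : Prop :=
  exists s x, rs_map (r := S) (s := s) x = y.

Definition stable (R : realType) (Y : Type) (S : relative_structure R Y)
    (d : Y -> Y -> \bar R) : Prop :=
  pseudometric d /\
  forall s (x1 x2 : rs_space (r := S) s),
    d (rs_map x1) (rs_map x2) <= rs_dist x1 x2.

Definition optimal (R : realType) (Y : Type) (S : relative_structure R Y)
    (d : Y -> Y -> \bar R) : Prop :=
  stable S d /\
  forall d', stable S d' ->
    forall y1 y2, rs_im S y1 -> rs_im S y2 -> d' y1 y2 <= d y1 y2.

Section SupDistance.
Variables (R : realType) (n : nat) (T : Type).
Implicit Types g : T -> 'rV[R]_n.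

(* The norm on row vectors is the sup norm; the maximum with 0 only matters when
   [T] is empty. *)
Definition sup_dist g1 g2 : \bar R :=
  maxe 0 (ereal_sup [set (`|(g1 x - g2 x)%R|)%:E | x in [set: T]]).

Lemma sup_dist_pseudometric : pseudometric sup_dist.
Proof.
have ge0 g1 g2 : 0 <= sup_dist g1 g2 by rewrite /sup_dist le_max lexx.
split=> // [g|g1 g2|g1 g2 g3].
- apply/eqP; rewrite eq_le ge0 andbT /sup_dist ge_max lexx /=.
  by apply: ge_ereal_sup => _ [x _ <-]; rewrite subrr normr0.
- rewrite /sup_dist; congr (maxe 0 (ereal_sup _)).
  by apply/seteqP; split=> _ [x _ <-]; exists x => //; rewrite distrC.
rewrite {1}/sup_dist ge_max adde_ge0 //=.
apply: ge_ereal_sup => _ [x _ <-].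
have le g g' : (`|(g x - g' x)%R|)%:E <= sup_dist g g'.
  by rewrite /sup_dist le_max ereal_sup_ubound ?orbT //; exists x.
apply: le_trans (leeD (le g1 g2) (le g2 g3)).
by rewrite -EFinD lee_fin; apply: ler_distD.
Qed.

End SupDistance.

Definition R1 (k : fieldType) (R : realType) (n : nat) :
    relative_structure R (isoclass k R n) :=
  @RelativeStructure R (isoclass k R n)
    (topologicalType * nat)%type
    (fun s => s.1 -> 'rV[R]_n)
    (fun s => @sup_dist R n s.1)
    (fun s => @sup_dist_pseudometric R n s.1)
    (fun s g => class_of (sublevel_homology k g s.2)).

(* Main.v *)
Require Import Defs.
From HB Require Import structures.
From mathcomp Require Import all_boot all_order all_algebra.
From mathcomp Require Import all_classical all_reals.
From mathcomp Require Import interval_inference ereal topology normedtype.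
From mathcomp Require Import ring lra.
From mathcomp.multinomials Require Import -(notations) monalg.
Import Order.TTheory GRing.Theory Num.Theory.
Import numFieldNormedType.Exports.

Set Implicit Arguments.
Unset Strict Implicit.
Unset Printing Implicit Defensive.

Local Open Scope classical_set_scope.
Local Open Scope ring_scope.

(* Stability of d_I comes from the inclusions of sublevel sets.  For optimality,
   an e-interleaving of M and N is a diagram V of vector spaces on the poset
   R^n x {0, 1} in which (a, s) <= (b, t) means a <= b if s = t and a + e <= b
   otherwise.  We build one space T, graded by this poset, such that
   H_1(T_{<= p}) is naturally V_p for all p.  The two gradings of T by R^n whose
   sublevel sets are the T_{<= (a, 0)} and the T_{<= (a, 1)} then realize M and N
   and differ by at most e in sup norm, so every stable pseudometric is at most e
   on (M, N).

   T is a preordered set with its Alexandrov topology (open = up-closed).  Its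
   elements of grade p model the simplices of the join V_p * V_p * V_p modulo
   translation by V_p; the join is simply connected and the action is free, so
   the first integral homology of the quotient is V_p, and V_p (x)_Z k = V_p
   because k is a prime field.  Instead of coverings, a V_p-valued 1-cocycle on
   the preorder is integrated along singular paths; any path is homologous to a
   sum of elementary edges [x <= y]. *)

(** * Linear identities in abelian groups *)

(** The obstacle is that a single space must realize both modules, with maps as well as objects, so
    the construction has to be functorial in [V] and cannot choose bases. Hence [V_p] itself, as a
    discrete group, supplies the vertices and acts by translation; degree 1 appears because the
    first homology of such a quotient is the acting abelian group. Two copies of [V_p] would only
    join to a graph with loops; triangles with one vertex in each of three copies are what makes the
    loop class additive. The cocycle is a difference of two vertices, a quantity that survives
    translation. Elements of grade below [p] lie under their images in grade [p], so they add
    nothing to the homology of the part below [p]. An element of grade [(a, s)] enters the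
    filtration with label [s] at [a] and the other one at [a + e], which is where the bound [e]
    comes from. *)

Inductive zexp := ZAtom of nat | ZZero | ZAdd of zexp & zexp | ZOpp of zexp.

Fixpoint zexp_eval (V : zmodType) (env : seq V) (e : zexp) : V :=
  match e with
  | ZAtom i => nth 0 env i
  | ZZero => 0
  | ZAdd e1 e2 => zexp_eval env e1 + zexp_eval env e2
  | ZOpp e1 => - zexp_eval env e1
  end.

Fixpoint zexp_coef (e : zexp) (i : nat) : int :=
  match e with
  | ZAtom j => Posz (i == j)
  | ZZero => 0
  | ZAdd e1 e2 => zexp_coef e1 i + zexp_coef e2 i
  | ZOpp e1 => - zexp_coef e1 i
  end.

Lemma zexp_evalE (V : zmodType) (env : seq V) e :
  zexp_eval env e = \sum_(i < size env) nth 0 env i *~ zexp_coef e i.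
Proof.
elim: e => [j||e1 h1 e2 h2|e1 h] /=; rewrite ?h1 ?h2 ?h.
- have [js|js] := ltnP j (size env).
    rewrite (bigD1 (Ordinal js)) //= eqxx big1 ?addr0 // => i /eqP ij.
    by rewrite (_ : (i == j :> nat) = false) //; apply/eqP => e; apply/ij/val_inj.
  rewrite nth_default // big1 // => i _.
  by rewrite (_ : (i == j :> nat) = false) // ltn_eqF // (leq_trans _ js).
- by rewrite big1 // => i _; rewrite mulr0z.
- by rewrite -big_split; apply: eq_bigr => i _; rewrite mulrzDr.
- by rewrite -sumrN; apply: eq_bigr => i _; rewrite mulrNz.
Qed.

(** Comparing integer coefficients is a computation, so [zmod] reifies a goal and discharges this
    check with [isT]. *)
Lemma zexp_eq (V : zmodType) (env : seq V) e1 e2 :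
  all (fun i => zexp_coef e1 i == zexp_coef e2 i) (iota 0 (size env)) ->
  zexp_eval env e1 = zexp_eval env e2.
Proof.
move=> /allP h; rewrite !zexp_evalE; apply: eq_bigr => i _.
by rewrite (eqP (h i _)) // mem_iota add0n ltn_ord.
Qed.

Ltac zmod_index a env :=
  lazymatch env with
  | a :: _ => constr:(0%N)
  | _ :: ?env' => let i := zmod_index a env' in constr:(i.+1)
  end.

Ltac zmod_insert a env :=
  lazymatch env with
  | context [cons a _] => env
  | _ => constr:(a :: env)
  end.

Ltac zmod_atoms e env :=
  lazymatch e with
  | (?a + ?b)%R => let env' := zmod_atoms a env in zmod_atoms b env'
  | (- ?a)%R => zmod_atoms a env
  | 0%R => env
  | _ => zmod_insert e env
  end.

Ltac zmod_reify e env :=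
  lazymatch e with
  | (?a + ?b)%R =>
      let x := zmod_reify a env in let y := zmod_reify b env in
      constr:(ZAdd x y)
  | (- ?a)%R => let x := zmod_reify a env in constr:(ZOpp x)
  | 0%R => constr:(ZZero)
  | _ => let i := zmod_index e env in constr:(ZAtom i)
  end.

Ltac zmod :=
  lazymatch goal with
  | |- @eq ?T ?l ?r =>
    let env := zmod_atoms l (@nil T) in
    let env := zmod_atoms r env in
    let x := zmod_reify l env in
    let y := zmod_reify r env in
    exact: (@zexp_eq _ env x y isT)
  end.


(** * Alexandrov spaces *)

Record preorder (T : Type) := Preorder {
  ple :> T -> T -> Prop;
  ple_refl : forall x, ple x x;
  ple_trans : forall x y z, ple x y -> ple y z -> ple x z }.

Definition alexandrov (T : Type) (r : preorder T) : Type := T.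

Section Alexandrov.
Variables (T : Type) (r : preorder T).
Local Notation A := (alexandrov r).

HB.instance Definition _ := gen_eqMixin A.
HB.instance Definition _ := gen_choiceMixin A.

Definition alex_nbhs (x : A) : set_system A := [set B | forall y, r x y -> B y].

HB.instance Definition _ := hasNbhs.Build A alex_nbhs.

Lemma alex_nbhs_filter (x : A) : ProperFilter (alex_nbhs x).
Proof.
split; first by move=> /(_ x (ple_refl r x)).
by split=> // [P Q hP hQ y xy|P Q PQ hP y xy];
  [split; [apply: hP|apply: hQ]|apply/PQ/hP].
Qed.

Lemma alex_nbhs_singleton (x : A) (B : set A) : alex_nbhs x B -> B x.
Proof. by apply; exact: ple_refl. Qed.

Lemma alex_nbhs_nbhs (x : A) (B : set A) :
  alex_nbhs x B -> alex_nbhs x (alex_nbhs^~ B).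
Proof. by move=> h y xy z yz; apply: h; exact: ple_trans yz. Qed.

HB.instance Definition _ := Nbhs_isNbhsTopological.Build A
  alex_nbhs_filter alex_nbhs_singleton alex_nbhs_nbhs.

End Alexandrov.

(** * Standard simplices *)

Section SimplexTopology.
Variables (R : realType) (m : nat).
Local Notation D := (simplex R m).

Definition bary (x : D) : 'rV[R]_m.+1 := sval x.

Lemma simplex_ge0 (x : D) j : 0 <= bary x ord0 j.
Proof. by have [h _] := set_valP x. Qed.

Lemma simplex_sum (x : D) : \sum_j bary x ord0 j = 1.
Proof. by have [_ h] := set_valP x. Qed.

Lemma simplex_le1 (x : D) j : bary x ord0 j <= 1.
Proof.
rewrite -(simplex_sum x) (bigD1 j) //= lerDl sumr_ge0 // => i _.
exact: simplex_ge0.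
Qed.

Lemma mx_norm_le (n : nat) (v : 'rV[R]_n) e : 0 <= e ->
  (forall j, `|v ord0 j| <= e) -> `|v| <= e.
Proof.
move=> e0 h; rewrite [leLHS]/Num.norm /= mx_normrE.
by apply/bigmax_leP; split=> // -[i j] _ /=; rewrite ord1.
Qed.

Lemma mx_norm_ge (n : nat) (v : 'rV[R]_n) j : `|v ord0 j| <= `|v|.
Proof.
rewrite [leRHS]/Num.norm /= mx_normrE.
by apply/bigmax_geP; right; exists (ord0, j).
Qed.

Lemma simplex_norm_le1 (x : D) : `|bary x| <= 1.
Proof.
by apply: mx_norm_le => // j; rewrite ger0_norm ?simplex_ge0 ?simplex_le1.
Qed.

Lemma simplex_nbhsP (x : D) (A : set D) :
  nbhs x A <-> exists2 e : R, 0 < e & forall y : D, `|bary x - bary y| < e -> A y.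
Proof.
split=> [/nbhs_ballP[e /= e0 h]|[e e0 h]].
  by exists e => // y xy; apply: h; rewrite -initial_ballE /= -ball_normE.
apply/nbhs_ballP; exists e => //= y; rewrite -initial_ballE /= -ball_normE.
exact: h.
Qed.

Lemma simplex_set_compact : compact (@simplex_set R m).
Proof.
apply: bounded_closed_compact.
  exists 1; split=> // M M1 x [x0 x1]; apply: le_trans (ltW M1).
  have xD : x \in @simplex_set R m by apply/mem_set.
  exact: (simplex_norm_le1
    (exist (fun y => is_true (y \in @simplex_set R m)) x xD)).
have -> : @simplex_set R m =
    \bigcap_j [set x : 'rV[R]_m.+1 | 0 <= x ord0 j] `&`
    (fun x : 'rV[R]_m.+1 => \sum_j x ord0 j) @^-1` [set 1].
  apply/seteqP; split=> x [h1 h2]; split=> // j; first by move=> _; exact: h1.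
  exact: (h1 j).
apply: closedI.
  apply: closed_bigI => j _.
  apply: (@closed_comp _ _ (fun x : 'rV[R]_m.+1 => x ord0 j) [set t | 0 <= t]).
    by move=> x _; exact: coord_continuous.
  exact: closed_ge.
apply: closed_comp; last exact: closed_eq.
move=> x _; apply: continuous_big => //=.
  exact: add_continuous.
by move=> j _; exact: coord_continuous.
Qed.

(** Lebesgue number lemma, from compactness in its near-covering form. *)
Lemma simplex_lebesgue (N : D -> set D) : (forall x, nbhs x (N x)) ->
  exists2 e : R, 0 < e &
    forall x, exists z, forall y : D, `|bary x - bary y| < e -> N z y.
Proof.
move=> hN.
pose P (e : R) (x : 'rV[R]_m.+1) :=
  exists z : D, forall y : D, `|x - bary y| < e -> N z y.
have : \forall e \near (0 : R)^'+, @simplex_set R m `<=` P e.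
  have /compact_near_coveringP := simplex_set_compact; apply => x xD.
  pose x' : D := exist (fun y => is_true (y \in @simplex_set R m)) x (mem_set xD).
  have /simplex_nbhsP[e e0 he] := hN x'.
  (* Half of the radius pays for moving the centre from [x] to [y], half for the ball around [y]. *)
  have e20 : 0 < e / 2 by rewrite divr_gt0.
  exists (ball x (e / 2), [set d | d < e / 2]).
    split; first exact: nbhsx_ballx.
    exact: nbhs_right_lt.
  move=> [y d] [/= xy de]; exists x' => z yz; apply: he => /=.
  rewrite -(subrKA y) (le_lt_trans (ler_normD _ _)) //.
  move: xy; rewrite -ball_normE /= => xy.
  by rewrite [e]splitr ltrD // (lt_trans yz).
move=> h; have [e [he e0]] :=
  @filter_ex _ (0 : R)^'+ _ _ (filterI h (nbhs_right_gt (0 : R))).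
by exists e => // x; exact: he (set_valP x).
Qed.

(** Clamping lets the whole line parametrize a segment of the simplex, so that connectedness of [R]
    applies to [mix x y]. *)
Definition clamp (t : R) : R := Num.max 0 (Num.min 1 t).

Lemma clamp_ge0 t : 0 <= clamp t.
Proof. by rewrite /clamp le_max lexx. Qed.

Lemma clamp_le1 t : clamp t <= 1.
Proof. by rewrite /clamp ge_max ler01 ge_min lexx. Qed.

Lemma clamp_id t : 0 <= t <= 1 -> clamp t = t.
Proof. by move=> /andP[t0 t1]; rewrite /clamp (min_r t1) (max_r t0). Qed.

Lemma clampP t : [\/ clamp t = t, clamp t = 0 /\ t <= 0 | clamp t = 1 /\ 1 <= t].
Proof.
have [t1|t1] := leP 1 t; first by apply: Or33; rewrite /clamp min_l ?max_r.
have [t0|t0] := leP 0 t; last by apply: Or32; rewrite /clamp min_r ?max_l // ltW.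
by apply: Or31; rewrite clamp_id // t0 ltW.
Qed.

Lemma clamp_lip s t : `|clamp s - clamp t| <= `|s - t|.
Proof.
wlog st : s t / s <= t => [hw|].
  by case/orP: (le_total s t) => /hw //; rewrite distrC [leRHS]distrC.
rewrite distrC [leRHS]distrC (ger0_norm (x := t - s)) ?subr_ge0 //.
have := clamp_ge0 s; have := clamp_ge0 t; have := clamp_le1 s.
have := clamp_le1 t; rewrite ler_norml.
by case: (clampP s) => [->|[-> ?]|[-> ?]];
  case: (clampP t) => [->|[-> ?]|[-> ?]] *; apply/andP; split; lra.
Qed.

Lemma mixP (x y : D) t :
  bary x + clamp t *: (bary y - bary x) \in @simplex_set R m.
Proof.
apply/mem_set; split=> [j|].
  rewrite !mxE; have := simplex_ge0 x j; have := simplex_ge0 y j.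
  by have := clamp_ge0 t; have := clamp_le1 t; nra.
under eq_bigr do rewrite !mxE mulrDr mulrN.
rewrite big_split /= sumrB -!mulr_sumr !simplex_sum; ring.
Qed.

Definition mix (x y : D) t : D :=
  exist (fun y => is_true (y \in @simplex_set R m)) _ (mixP x y t).

Lemma mix_lip x y s t : `|bary (mix x y s) - bary (mix x y t)| <= `|s - t| * 2.
Proof.
rewrite /= opprD addrACA subrr add0r -scalerBl normrZ.
apply: ler_pM => //; first exact: clamp_lip.
rewrite (le_trans (ler_normB _ _)) // -[2]/(1 + 1) lerD //.
all: exact: simplex_norm_le1.
Qed.

Lemma mix0 x y : mix x y 0 = x.
Proof.
by apply/val_inj; rewrite /= clamp_id ?scale0r ?addr0 // lexx ler01.
Qed.

Lemma mix1 x y : mix x y 1 = y.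
Proof.
by apply/val_inj; rewrite /= clamp_id ?scale1r ?subrKC // lexx ler01.
Qed.

Lemma vertexP (i : 'I_m.+1) : delta_mx ord0 i \in @simplex_set R m.
Proof.
apply/mem_set; split=> [j|]; first by rewrite mxE ler0n.
rewrite (bigD1 i) //= mxE !eqxx big1 ?addr0 // => j /negbTE ji.
by rewrite mxE ji andbF.
Qed.

Definition vertex (i : 'I_m.+1) : D :=
  exist (fun y => is_true (y \in @simplex_set R m)) _ (vertexP i).

Definition mix_convex (B : set D) :=
  forall x y, B x -> B y -> forall t, B (mix x y t).

(** Along the segment from [x] to [y], the level set of [h x] is open and closed in the line. *)
Lemma locally_constant (W : Type) (B : set D) (h : D -> W) : mix_convex B ->
  (forall x, B x -> \forall y \near x, B y -> h y = h x) ->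
  forall x y, B x -> B y -> h x = h y.
Proof.
move=> Bc hh x y Bx By.
have near_eq t : \forall s \near t, h (mix x y s) = h (mix x y t).
  have /simplex_nbhsP[e e0 he] := hh _ (Bc x y Bx By t).
  apply/nbhs_ballP; exists (e / 2); first by rewrite /= divr_gt0.
  move=> s; rewrite -ball_normE /= ltr_pdivlMr // => ts.
  by apply: he (Bc _ _ Bx By _); apply: le_lt_trans ts; exact: mix_lip.
pose A := [set t : R | h (mix x y t) = h x].
have cA : connected [set: R] by apply/connected_intervalP.
have oA : open A.
  rewrite openE => t /= At; have := near_eq t.
  by apply: filterS => s; rewrite At.
have clA : closed A.
  rewrite -openC openE => t /= At; have := near_eq t.
  by apply: filterS => s /= e; rewrite /A /= e.
have -> // : h x = h y.
suff : A = setT.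
  by move=> AT; rewrite -[in RHS](mix1 x y); have : A 1 by rewrite AT.
apply: cA.
- by exists 0; rewrite /A /= mix0.
- by exists A => //; rewrite setTI.
- by exists A => //; rewrite setTI.
Qed.

Lemma ball_mix_convex (a : D) e : mix_convex [set y : D | `|bary a - bary y| < e].
Proof.
move=> x y /= xe ye t; have t0 := clamp_ge0 t; have t1 := clamp_le1 t.
have -> : bary a - (bary x + clamp t *: (bary y - bary x)) =
  (1 - clamp t) *: (bary a - bary x) + clamp t *: (bary a - bary y).
  by rewrite scalerBl scale1r !scalerBr !opprD !opprK;
     apply/rowP => j; rewrite !mxE; ring.
apply: le_lt_trans (ler_normD _ _) _; rewrite !normrZ.
rewrite (ger0_norm t0) (ger0_norm (x := 1 - clamp t)) ?subr_ge0 //.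
move: xe ye; set p := `|_ - bary x|; set q := `|_ - bary y| => xe ye.
have -> : e = (1 - clamp t) * e + clamp t * e by ring.
move: t0; rewrite le_eqVlt => /predU1P[<-|t0].
  by rewrite !mul0r !addr0 subr0 !mul1r.
by rewrite ler_ltD ?ltr_pM2l // ler_wpM2l ?subr_ge0 // ltW.
Qed.

Lemma mix_convexI B C : mix_convex B -> mix_convex C -> mix_convex (B `&` C).
Proof. by move=> hB hC x y [Bx Cx] [By Cy] t; split; [apply: hB|apply: hC]. Qed.

End SimplexTopology.

(** * Primitives of cocycles on a simplex *)

Section Primitive.
Variables (R : realType) (m : nat) (V : zmodType).
Local Notation D := (simplex R m).

(** A primitive plays the role of a lift to the covering with fibre [V] that the cocycle defines. *)
Definition primitive (c : D -> D -> V) (u : D -> V) :=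
  forall x, \forall y \near x, u y = u x + c x y.

Lemma primitive_uniq c u u' : primitive c u -> primitive c u' ->
  forall x y, u y - u x = u' y - u' x.
Proof.
move=> hu hu' x y; suff : u y - u' y = u x - u' x.
  by move=> /eqP; rewrite subr_eq => /eqP ->; zmod.
apply: (@locally_constant R m V setT (fun x => u x - u' x)) => // z _.
apply: filterS2 (hu z) (hu' z) => t -> -> _.
zmod.
Qed.

Variables (N : D -> set D) (c : D -> D -> V).
Hypothesis N_nbhs : forall x, nbhs x (N x).
Hypothesis c_cocycle : forall x y z, N x y -> N y z -> c x z = c x y + c y z.

Lemma cocycle_refl x : c x x = 0.
Proof.
have xx : N x x := nbhs_singleton (N_nbhs x).
by have /eqP := c_cocycle xx xx; rewrite eq_sym -subr_eq0 addrK => /eqP.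
Qed.

(** Both [c z] and [c z'] are primitives on [B], so they differ there by a constant. *)
Lemma cocycle_patch (B : set D) z z' a b : mix_convex B ->
  B `<=` N z -> B `<=` N z' -> B a -> B b ->
  c z b - c z a = c z' b - c z' a.
Proof.
move=> Bc hz hz' Ba Bb; suff : c z b - c z' b = c z a - c z' a.
  by move=> /eqP; rewrite subr_eq => /eqP ->; zmod.
apply: (locally_constant Bc (h := fun x => c z x - c z' x)) => // x Bx.
apply: filterS (N_nbhs x) => y xy _.
rewrite (c_cocycle (hz _ Bx) xy) (c_cocycle (hz' _ Bx) xy); zmod.
Qed.

(* Lift along the homotopy that contracts the simplex to a vertex, in steps
   shorter than a Lebesgue number. *)
Lemma exists_primitive : exists u, primitive c u.
Proof.
have [e e0 /choice[z hz]] := simplex_lebesgue N_nbhs.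
pose v0 : D := vertex R ord0.
(* [mix] moves with speed at most 2, so each of the [M.+1] steps is shorter than a quarter of the
   Lebesgue number. *)
have [M hM] : exists M : nat, 2 / M.+1%:R < e / 4 :> R.
  exists (Num.truncn (2 / (e / 4))).
  rewrite ltr_pdivrMr ?ltr0Sn // mulrC -ltr_pdivrMr ?divr_gt0 //.
  exact: truncnS_gt.
pose s (k : nat) x := mix v0 x (k%:R / M.+1%:R).
have s_lip k x y : `|bary (s k x) - bary (s k y)| <= `|bary x - bary y|.
  rewrite /s /bary /= opprD addrACA subrr add0r -scalerBr opprB addrA subrK.
  by rewrite normrZ (ger0_norm (clamp_ge0 _)) ler_piMl // clamp_le1.
have s_step k x : `|bary (s k x) - bary (s k.+1 x)| < e / 4.
  apply: le_lt_trans hM; apply: le_trans (mix_lip _ _ _ _) _.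
  rewrite distrC -mulrBl -natr1 addrAC subrr add0r mul1r.
  by rewrite mulrC ger0_norm ?invr_ge0.
(* Stage [k] integrates the pullback of [c] along [s k]; [s 0] is constant and [s M.+1] is the
   identity. *)
suff h k : exists u, forall x, \forall y \near x, u y = u x + c (s k x) (s k y).
  have [u hu] := h M.+1; exists u => x; have := hu x.
  have sE y : s M.+1 y = y by rewrite /s divff ?pnatr_eq0 // mix1.
  by apply: filterS => y; rewrite !sE.
elim: k => [|k [u hu]].
  exists (fun => 0) => x; apply/simplex_nbhsP; exists 1 => // y _.
  by rewrite /s mul0r !mix0 cocycle_refl addr0.
(* The increment from [a] to [b] is read off in the patch of [z a], which contains the ball of
   radius [e] around [a]. *)
pose d a b := c (z a) b - c (z a) a.
exists (fun x => u x + d (s k x) (s k.+1 x)) => x.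
have sk_nbhs j A : nbhs (s j x) A -> nbhs x [set y | A (s j y)].
  move=> /simplex_nbhsP[r r0 hr]; apply/simplex_nbhsP; exists r => // y xy.
  by apply: hr; apply: le_lt_trans xy; exact: s_lip.
have near_x : \forall y \near x, `|bary x - bary y| < e / 4.
  by apply/simplex_nbhsP; exists (e / 4); rewrite ?divr_gt0.
near=> y.
(* All four points [s k x], [s k y], [s k.+1 x], [s k.+1 y] lie in [B], where the two patches give
   the same increments. *)
pose B := [set t : D | `|bary (s k x) - bary t| < e] `&`
          [set t : D | `|bary (s k y) - bary t| < e].
have Bc : mix_convex B by apply: mix_convexI; exact: ball_mix_convex.
have hx : B `<=` N (z (s k x)) by move=> t [ht _]; exact: hz ht.
have hy : B `<=` N (z (s k y)) by move=> t [_ ht]; exact: hz ht.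
have xy : `|bary x - bary y| < e / 4 by near: y.
have xy' j : `|bary (s j x) - bary (s j y)| < e / 4.
  exact: le_lt_trans (s_lip _ _ _) xy.
have yx' j : `|bary (s j y) - bary (s j x)| < e / 4 by rewrite distrC.
have e4 : e / 4 < e by rewrite ltr_pdivrMr // ltr_pMr // ltr1n.
have e2 (p q r : D) : `|bary p - bary q| < e / 4 ->
    `|bary q - bary r| < e / 4 -> `|bary p - bary r| < e.
  move=> pq qr; rewrite -(subrKA (bary q)) (le_lt_trans (ler_normD _ _)) //.
  lra.
have B1 : B (s k x).
  by split=> /=; [rewrite subrr normr0|exact: lt_trans (yx' k) e4].
have B2 : B (s k y).
  by split=> /=; [exact: lt_trans (xy' k) e4|rewrite subrr normr0].
have B3 : B (s k.+1 x).
  by split; [exact: lt_trans (s_step k x) e4|exact: e2 (yx' k) (s_step k x)].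
have B4 : B (s k.+1 y).
  by split; [exact: e2 (xy' k) (s_step k y)|exact: lt_trans (s_step k y) e4].
have -> : d (s k y) (s k.+1 y) = c (z (s k x)) (s k.+1 y) - c (z (s k x)) (s k y).
  exact: cocycle_patch Bc hy hx B2 B4.
have -> : c (z (s k x)) (s k.+1 y) =
    c (z (s k x)) (s k.+1 x) + c (s k.+1 x) (s k.+1 y).
  by apply: c_cocycle; [exact: hx|near: y; exact: sk_nbhs].
have -> : c (z (s k x)) (s k y) = c (z (s k x)) (s k x) + c (s k x) (s k y).
  by apply: c_cocycle; [exact: hx|near: y; exact: sk_nbhs].
have -> : u y = u x + c (s k x) (s k y) by near: y; exact: hu.
rewrite /d; zmod.
Unshelve. all: by end_near. Qed.

End Primitive.

Section SimplexVertices.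
Variable R : realType.

Lemma baryP m (x y : simplex R m) :
  (forall j, bary x ord0 j = bary y ord0 j) -> x = y.
Proof. by move=> h; apply/val_inj/rowP. Qed.

Lemma bary_face m (j : 'I_m.+2) (x : simplex R m) l :
  bary (face R j x) ord0 l = oapp (bary x ord0) 0 (unlift j l).
Proof. by rewrite /bary /= mxE. Qed.

Lemma face_vertex m (j : 'I_m.+2) (i : 'I_m.+1) :
  face R j (vertex R i) = vertex R (lift j i).
Proof.
apply: baryP => l; rewrite bary_face /bary /= !mxE /=.
case: unliftP => [l' ->|->] /=; last by rewrite (negbTE (neq_lift _ _)).
by rewrite mxE /= (inj_eq (@lift_inj _ _)).
Qed.

Local Notation o0 := (@ord0 _).
Local Notation o1 := (lift ord0 (@ord0 _)).
Local Notation o2 := (lift ord0 (lift ord0 (@ord0 _))).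

Lemma bary_face0 m (x : simplex R m) :
  bary (face R o0 x) ord0 o0 = 0 /\
  forall l, bary (face R o0 x) ord0 (lift o0 l) = bary x ord0 l.
Proof.
by split=> [|l]; rewrite bary_face ?unlift_none ?liftK.
Qed.

Lemma bary_face1 (x : simplex R 1) :
  [/\ bary (face R o1 x) ord0 o0 = bary x ord0 o0,
      bary (face R o1 x) ord0 o1 = 0 &
      bary (face R o1 x) ord0 o2 = bary x ord0 o1].
Proof.
split; rewrite bary_face ?unlift_none //.
- have -> : (ord0 : 'I_3) = lift (lift ord0 ord0) ord0 by apply/val_inj.
  by rewrite liftK.
- have -> : (lift ord0 (lift ord0 ord0) : 'I_3) = lift o1 (lift ord0 ord0)
    by apply/val_inj.
  by rewrite liftK.
Qed.

Lemma bary_face2 (x : simplex R 1) :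
  [/\ bary (face R o2 x) ord0 o0 = bary x ord0 o0,
      bary (face R o2 x) ord0 o1 = bary x ord0 o1 &
      bary (face R o2 x) ord0 o2 = 0].
Proof.
split; rewrite bary_face ?unlift_none //.
- have -> : (ord0 : 'I_3) = lift o2 ord0 by apply/val_inj.
  by rewrite liftK.
- have -> : (lift ord0 ord0 : 'I_3) = lift o2 (lift ord0 ord0)
    by apply/val_inj.
  by rewrite liftK.
Qed.

Lemma bary1_sum (x : simplex R 1) : bary x ord0 o0 = 1 - bary x ord0 o1.
Proof.
have := simplex_sum x; rewrite !big_ord_recl big_ord0 addr0 => <-.
by rewrite addrK.
Qed.

Definition seg_pt (t : R) : simplex R 1 := mix (vertex R o0) (vertex R o1) t.

Lemma bary_seg_pt t : bary (seg_pt t) ord0 o1 = clamp t.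
Proof. by rewrite /bary /= !mxE /= mulr0n subr0 mulr1 add0r. Qed.

Lemma seg_ptK (x : simplex R 1) : seg_pt (bary x ord0 o1) = x.
Proof.
have e : bary (seg_pt (bary x ord0 o1)) ord0 o1 = bary x ord0 o1.
  by rewrite bary_seg_pt clamp_id // simplex_ge0 simplex_le1.
apply: baryP => j; have [->//|->] : j = o1 \/ j = o0.
  by case: j => [[|[|//]] h]; [right|left]; apply/val_inj.
by rewrite !bary1_sum e.
Qed.

Lemma seg_pt0 : seg_pt 0 = vertex R o0.
Proof. exact: mix0. Qed.

Lemma seg_pt1 : seg_pt 1 = vertex R o1.
Proof. exact: mix1. Qed.

Lemma seg_pt_near t A : nbhs (seg_pt t) A -> \forall s \near t, A (seg_pt s).
Proof.
move=> /simplex_nbhsP[e e0 he]; apply/nbhs_ballP; exists (e / 2).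
  by rewrite /= divr_gt0.
move=> s; rewrite -ball_normE /= ltr_pdivlMr // => ts; apply: he.
by apply: le_lt_trans ts; exact: mix_lip.
Qed.

Lemma bary_near m (x : simplex R m) j (A : set R) :
  nbhs (bary x ord0 j) A -> \forall y \near x, A (bary y ord0 j).
Proof.
move=> /nbhs_ballP[e /= e0 he]; apply/simplex_nbhsP; exists e => // y xy.
apply: he; rewrite -ball_normE /=; apply: le_lt_trans xy.
by have := mx_norm_ge (bary x - bary y) j; rewrite !mxE.
Qed.

Lemma bary_continuous m (j : 'I_m.+1) :
  continuous (fun x : simplex R m => bary x ord0 j).
Proof. by move=> x A; exact: bary_near. Qed.

End SimplexVertices.

(** * Singular homology of Alexandrov spaces in degree one *)

Section AlexandrovPaths.
Variables (R : realType) (X : topologicalType) (le : X -> X -> Prop).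

(* [X] is an Alexandrov space with specialization preorder [le]. *)
Definition alexandrov_for :=
  (forall (x : X) A, nbhs x A <-> forall y, le x y -> A y) /\
  (forall x y z, le x y -> le y z -> le x z).

Hypothesis hX : alexandrov_for.

Lemma alex_refl x : le x x.
Proof. by apply: (@nbhs_singleton X x); apply/hX.1. Qed.

Lemma alex_continuous (S : topologicalType) (f : S -> X) :
  (forall x, \forall y \near x, le (f x) (f y)) -> continuous f.
Proof.
by move=> hf x A /hX.1 hA; apply: filterS (hf x) => y; exact: hA.
Qed.

Lemma alex_near (S : topologicalType) (f : continuousType S X) (x : S) :
  \forall y \near x, le (f x) (f y).
Proof. by apply: (@cts_fun _ _ f x); apply/hX.1. Qed.

Local Notation D m := (simplex R m).
Local Notation o0 := (@ord0 _).
Local Notation o1 := (lift ord0 (@ord0 _)).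
Local Notation o2 := (lift ord0 (lift ord0 (@ord0 _))).

(* The open sets are up-closed, so a path may leave [x] by jumping to [y]. *)
Lemma edge_continuous x y (h : le x y) :
  continuous (fun s : D 1 => if bary s ord0 o0 == 1 then x else y).
Proof.
apply: alex_continuous => s; case: eqP => [e|/eqP e].
  by apply/simplex_nbhsP; exists 1 => // t _; case: ifP => // _; exact: alex_refl.
have /bary_near : nbhs (bary s ord0 o0) [set t | t != 1].
  by apply: open_nbhs_nbhs; split=> //; exact: open_neq.
by apply: filterS => t /= /negbTE ->; exact: alex_refl.
Qed.

Definition edge x y (h : le x y) : continuousType (D 1) X :=
  mkcts (edge_continuous h).

Variable sg : continuousType (D 1) X.

Lemma reparam_continuous m (f : D m -> R) s :
  {for s, continuous f} ->
  \forall t \near s, le (sg (seg_pt (f s))) (sg (seg_pt (f t))).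
Proof.
move=> hf; apply: (hf [set r | le (sg (seg_pt (f s))) (sg (seg_pt r))]).
exact: (seg_pt_near (alex_near sg (seg_pt (f s)))).
Qed.

(** The affine function with value [v_j] at vertex [j]; [affine] feeds it to the path, so
    [[:: a; b]] cuts out the piece between the parameters [a] and [b]. *)
Definition affine_coord m (v : seq R) (s : D m) : R :=
  \sum_j bary s ord0 j * v`_j.

Lemma affine_coord_continuous m v : continuous (@affine_coord m v).
Proof.
apply: continuous_big => //=; first exact: add_continuous.
move=> j _ t; apply: (@continuousM R (simplex R m) (fun x => bary x ord0 j) (cst v`_j)).
  exact: bary_continuous.
exact: cst_continuous.
Qed.

Lemma affine_continuous m (v : seq R) :
  continuous (fun s : D m => sg (seg_pt (affine_coord v s))).
Proof.
apply: alex_continuous => s; apply: reparam_continuous.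
exact: affine_coord_continuous.
Qed.

Definition affine m (v : seq R) : continuousType (D m) X :=
  mkcts (@affine_continuous m v).

Variable x : X.
Hypothesis x_le : forall t, le x (sg t).

(* Continuity at the apex is free: every neighbourhood of [x] contains all the
   values of [sg]. *)
Definition cone_fun (s : D 2) : X :=
  if bary s ord0 o0 == 1 then x
  else sg (seg_pt (bary s ord0 o2 / (1 - bary s ord0 o0))).

Lemma cone_continuous : continuous cone_fun.
Proof.
apply: alex_continuous => s; rewrite /cone_fun; case: eqP => [e|/eqP e].
  apply/simplex_nbhsP; exists 1 => // t _; case: ifP => // _.
  exact: alex_refl.
have /bary_near h : nbhs (bary s ord0 o0) [set t | t != 1].
  by apply: open_nbhs_nbhs; split=> //; exact: open_neq.
have h' := @reparam_continuous 2 (fun t => bary t ord0 o2 / (1 - bary t ord0 o0)) s.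
apply: filterS2 h (h' _); first by move=> t /= /negbTE ->.
apply: continuousM; first exact: bary_continuous.
apply: continuousV; first by rewrite subr_eq0 eq_sym.
by apply: continuousB; [exact: cst_continuous|exact: bary_continuous].
Qed.

Definition cone : continuousType (D 2) X := mkcts cone_continuous.

Lemma cone_face0 : cone \o face R o0 = sg :> (D 1 -> X).
Proof.
apply/funext => s; rewrite /= /mkcts /cone_fun.
have [e0 e1] := bary_face0 s.
by rewrite e1 e0 subr0 divr1 seg_ptK eq_sym oner_eq0.
Qed.

Lemma cone_face1 :
  cone \o face R o1 = edge (x_le (vertex R o1)) :> (D 1 -> X).
Proof.
apply/funext => s; rewrite /= /mkcts /cone_fun.
have [-> _ ->] := bary_face1 s; case: eqP => // /eqP s1.
rewrite bary1_sum subKr divff ?seg_pt1 //.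
by apply: contra s1; rewrite bary1_sum => /eqP ->; rewrite subr0.
Qed.

Lemma cone_face2 :
  cone \o face R o2 = edge (x_le (vertex R o0)) :> (D 1 -> X).
Proof.
apply/funext => s; rewrite /= /mkcts /cone_fun.
have [-> _ ->] := bary_face2 s; case: eqP => // _.
by rewrite mul0r seg_pt0.
Qed.

End AlexandrovPaths.

Section AffineFaces.
Variables (R : realType) (X : topologicalType) (le : X -> X -> Prop).
Hypothesis hX : alexandrov_for le.
Variable sg : continuousType (simplex R 1) X.
Local Notation D m := (simplex R m).
Local Notation o0 := (@ord0 _).
Local Notation o1 := (lift ord0 (@ord0 _)).
Local Notation o2 := (lift ord0 (lift ord0 (@ord0 _))).

Lemma affine_face0 a b c :
  affine hX sg 2 [:: a; b; c] \o face R o0 = affine hX sg 1 [:: b; c] :> (D 1 -> X).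
Proof.
apply/funext => s; rewrite /= /mkcts /affine_coord !big_ord_recl !big_ord0.
have [e0 e1] := bary_face0 s.
by rewrite !e1 e0 /= mul0r add0r.
Qed.

Lemma affine_face1 a b c :
  affine hX sg 2 [:: a; b; c] \o face R o1 = affine hX sg 1 [:: a; c] :> (D 1 -> X).
Proof.
apply/funext => s; rewrite /= /mkcts /affine_coord !big_ord_recl !big_ord0.
by have [-> -> ->] := bary_face1 s; rewrite /= mul0r add0r.
Qed.

Lemma affine_face2 a b c :
  affine hX sg 2 [:: a; b; c] \o face R o2 = affine hX sg 1 [:: a; b] :> (D 1 -> X).
Proof.
apply/funext => s; rewrite /= /mkcts /affine_coord !big_ord_recl !big_ord0.
by have [-> -> ->] := bary_face2 s; rewrite /= mul0r !addr0.
Qed.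

Lemma affine01 : affine hX sg 1 [:: 0; 1] = sg :> (D 1 -> X).
Proof.
apply/funext => s; rewrite /= /mkcts /affine_coord !big_ord_recl !big_ord0.
by rewrite /= mulr0 mulr1 addr0 add0r seg_ptK.
Qed.

Lemma affine_between a b s : a <= b ->
  exists2 t, a <= t <= b & affine hX sg 1 [:: a; b] s = sg (seg_pt t).
Proof.
move=> ab; exists (a + bary s ord0 o1 * (b - a)).
  have := simplex_ge0 s o1; have := simplex_le1 s o1.
  by move: (bary s ord0 o1) => t t1 t0; apply/andP; split; nra.
rewrite /= /mkcts /affine_coord !big_ord_recl !big_ord0 /= bary1_sum addr0.
by congr (sg (seg_pt _)); ring.
Qed.

End AffineFaces.

(** * Singular 1-chains modulo boundaries *)

Section BoundaryQuotient.
Variables (k : fieldType) (R : realType) (X : topologicalType).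
Local Notation D m := (simplex R m).
Local Notation o0 := (@ord0 _).
Local Notation o1 := (lift ord0 (@ord0 _)).
Local Notation o2 := (lift ord0 (lift ord0 (@ord0 _))).

Definition simplex_chain m (s : continuousType (D m) X) : chain k R X m :=
  mkmalgU s 1.

Lemma simplex_chain_eq m (s t : continuousType (D m) X) :
  s = t :> (D m -> X) -> simplex_chain s = simplex_chain t.
Proof. by move=> e; congr simplex_chain; apply/continuousEP => x; rewrite e. Qed.

Lemma boundary2 (s : continuousType (D 2) X) :
  boundary k R X 1 (simplex_chain s) =
  simplex_chain (s \o face R o0) - simplex_chain (s \o face R o1) +
  simplex_chain (s \o face R o2).
Proof.
rewrite /simplex_chain /boundary /= malg_liftU scale1r /singular_boundary.
rewrite !big_ord_recl big_ord0 addr0 expr0 scale1r expr1 scaleN1r.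
by rewrite /= /bump /= !addn0 -signr_odd /= expr0 scale1r addrA.
Qed.

Lemma boundary1 (s : continuousType (D 1) X) :
  boundary k R X 0 (simplex_chain s) =
  simplex_chain (s \o face R o0) - simplex_chain (s \o face R o1).
Proof.
rewrite /simplex_chain /boundary /= malg_liftU scale1r /singular_boundary.
by rewrite !big_ord_recl big_ord0 addr0 expr0 scale1r expr1 scaleN1r.
Qed.

(** All 1-chains are divided by the boundaries, not only the cycles, so that single edges and open
    paths have classes. *)
Definition boundary_pred : {pred chain k R X 1} :=
  fun z => `[< exists w, z = boundary k R X 1 w >].

Lemma boundary_submod_closed : GRing.submod_closed boundary_pred.
Proof.
rewrite /boundary_pred; split=> [|c u v]; rewrite !unfold_in.
  by apply/asboolP; exists 0; rewrite linear0.
move=> /asboolP[a ->] /asboolP[b ->]; apply/asboolP; exists (c *: a + b).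
by rewrite linearP.
Qed.
HB.instance Definition _ := GRing.isSubmodClosed.Build k (chain k R X 1)
  boundary_pred boundary_submod_closed.

Definition chain_quot : lmodType k := lmod_quot boundary_pred.

Definition chain_pi : {linear chain k R X 1 -> chain_quot} :=
  lmod_pi boundary_pred.

Lemma chain_piP u v :
  chain_pi u = chain_pi v <-> exists w, u - v = boundary k R X 1 w.
Proof.
rewrite /chain_pi /=; split=> [/lmod_piP|h].
  by rewrite unfold_in => /asboolP.
by apply/lmod_piP; rewrite unfold_in; apply/asboolP.
Qed.

Lemma chain_pi_boundary w : chain_pi (boundary k R X 1 w) = 0.
Proof. by rewrite -(linear0 chain_pi); apply/chain_piP; exists w; rewrite subr0. Qed.

Lemma chain_pi2 (s : continuousType (D 2) X) :
  chain_pi (simplex_chain (s \o face R o1)) =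
  chain_pi (simplex_chain (s \o face R o2)) +
  chain_pi (simplex_chain (s \o face R o0)).
Proof.
have := chain_pi_boundary (simplex_chain s).
rewrite boundary2 linearD linearB /= => /eqP; rewrite addrAC subr_eq0 => /eqP <-.
exact: addrC.
Qed.

End BoundaryQuotient.

(** * Integration of cocycles and normal forms of chains *)

Section Cochain.
Variables (k : fieldType) (R : realType) (X : topologicalType).
Variables (le : X -> X -> Prop) (V : lmodType k) (c : X -> X -> V).
Hypothesis hX : alexandrov_for le.
Local Notation D m := (simplex R m).
Local Notation o0 := (@ord0 _).
Local Notation o1 := (lift ord0 (@ord0 _)).
Local Notation o2 := (lift ord0 (lift ord0 (@ord0 _))).

Definition cocycle := forall x y z, le x y -> le y z -> c x z = c x y + c y z.
Hypothesis hc : cocycle.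

Definition path_primitive m (s : continuousType (D m) X) :=
  primitive (fun x y => c (s x) (s y)).

Lemma cocycle0 x : c x x = 0.
Proof.
have := hc (alex_refl hX x) (alex_refl hX x).
by move/eqP; rewrite eq_sym -subr_eq0 addrK => /eqP.
Qed.

(** Continuity puts nearby values of [s] above [s x], where the cocycle identity is available. *)
Lemma exists_path_primitive m (s : continuousType (D m) X) :
  exists u, path_primitive s u.
Proof.
apply: (@exists_primitive R m V (fun x => [set y | le (s x) (s y)])).
- by move=> x; exact: (alex_near hX s x).
- by move=> x y z /= xy yz; exact: hc xy yz.
Qed.

Lemma path_primitive_face m (s : continuousType (D m.+1) X) u j :
  path_primitive s u -> path_primitive (s \o face R j) (u \o face R j).
Proof.
by move=> hu x; apply: (@cts_fun _ _ (face R j) x _ (hu (face R j x))).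
Qed.

Lemma exists_path_integral (s : continuousType (D 1) X) :
  exists v, forall u, path_primitive s u ->
    v = u (vertex R o1) - u (vertex R o0).
Proof.
have [u hu] := exists_path_primitive s.
by exists (u (vertex R o1) - u (vertex R o0)) => u' hu'; exact: (primitive_uniq hu hu').
Qed.

Definition path_integral (s : continuousType (D 1) X) : V :=
  projT1 (cid (exists_path_integral s)).

Lemma path_integralE s u : path_primitive s u ->
  path_integral s = u (vertex R o1) - u (vertex R o0).
Proof. by rewrite /path_integral; case: cid => v /= h /h. Qed.

Definition integral : {linear chain k R X 1 -> V} := malg_lift path_integral.

Lemma integralE s : integral (simplex_chain k s) = path_integral s.
Proof. by rewrite /integral /simplex_chain /= malg_liftU scale1r. Qed.

Lemma lift_vertexE : [/\ (lift o1 ord0 : 'I_3) = o0, (lift o1 o1 : 'I_3) = o2,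
  (lift o2 ord0 : 'I_3) = o0 & (lift o2 o1 : 'I_3) = o1].
Proof. by split; apply/val_inj. Qed.

(** A primitive on the whole 2-simplex restricts to its three faces, and the differences
    telescope. *)
Lemma integral_boundary w : integral (boundary k R X 1 w) = 0.
Proof.
move: w; apply: (malg_linear_ext (f := integral \o boundary k R X 1) (g := \0)) => s.
change (integral (boundary k R X 1 (simplex_chain k s)) = 0).
rewrite boundary2 linearD linearB !integralE.
have [u hu] := exists_path_primitive s.
have [e1 e2 e3 e4] := lift_vertexE.
rewrite !(path_integralE (path_primitive_face _ hu)) /= !face_vertex e1 e2 e3 e4.
zmod.
Qed.

Lemma integral_edge x y (h : le x y) :
  integral (simplex_chain k (edge R hX h)) = c x y.
Proof.
rewrite integralE (path_integralE
  (u := fun s => if bary s ord0 o0 == 1 then 0 else c x y)).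
  by rewrite /bary /= !mxE /= eqxx eq_sym oner_eq0 subr0.
move=> s; rewrite /= /mkcts; case: eqP => [e|/eqP e].
  apply/simplex_nbhsP; exists 1 => // t _; rewrite add0r.
  by case: ifP => // _; rewrite cocycle0.
have /bary_near : nbhs (bary s ord0 o0) [set t | t != 1].
  by apply: open_nbhs_nbhs; split=> //; exact: open_neq.
by apply: filterS => t /= /negbTE ->; rewrite cocycle0 addr0.
Qed.

(* Below, [L (c x y)] is the class of a loop along which [c] integrates to
   [c x y], and [th x] the class of a path from a base point to [x]. *)
Variables (L : {linear V -> chain_quot k R X}) (th : X -> chain_quot k R X).
Hypothesis edge_class : forall x y (h : le x y),
  chain_pi k R X (simplex_chain k (edge R hX h)) = L (c x y) + th y - th x.

Definition endpoint_class : {linear chain k R X 0 -> chain_quot k R X} :=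
  malg_lift (fun s : continuousType (D 0) X => th (s (vertex R ord0))).

(** By [edge_class], edges have the class prescribed here; subdivision extends this to all chains,
    and on cycles the endpoint term vanishes. *)
Definition normal_form : {linear chain k R X 1 -> chain_quot k R X} :=
  (L \o integral) \+ (endpoint_class \o boundary k R X 0).

Local Notation pi := (chain_pi k R X).
Local Notation good z := (pi z = normal_form z).

Lemma endpoint_classE (s : continuousType (D 0) X) :
  endpoint_class (simplex_chain k s) = th (s (vertex R ord0)).
Proof. by rewrite /endpoint_class /simplex_chain /= malg_liftU scale1r. Qed.

Lemma normal_formE s : normal_form (simplex_chain k s) =
  L (path_integral s) + th (s (vertex R o1)) - th (s (vertex R o0)).
Proof.
rewrite -[LHS]/(L (integral _) + endpoint_class (boundary k R X 0 _)).
rewrite integralE boundary1 linearB !endpoint_classE /=.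
rewrite !face_vertex addrA; congr (_ + th (s (vertex R _)) - th (s (vertex R _))).
exact/val_inj.
Qed.

Lemma good_boundary w : good (boundary k R X 1 w).
Proof.
rewrite chain_pi_boundary; symmetry; move: w.
apply: (malg_linear_ext (f := normal_form \o boundary k R X 1) (g := \0)) => s.
change (normal_form (boundary k R X 1 (simplex_chain k s)) = 0).
rewrite boundary2 linearD linearB !normal_formE.
have := integral_boundary (simplex_chain k s).
rewrite boundary2 linearD linearB !integralE.
set p0 := path_integral _; set p1 := path_integral _; set p2 := path_integral _.
move=> /eqP; rewrite addrAC subr_eq0 => /eqP <-.
rewrite [L (p0 + p2)]linearD /= !face_vertex.
have [-> -> -> ->] := lift_vertexE.
zmod.
Qed.

Lemma good_edge x y (h : le x y) : good (simplex_chain k (edge R hX h)).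
Proof.
rewrite edge_class normal_formE -integralE integral_edge.
by rewrite /= /mkcts /bary /= !mxE /= eqxx eq_sym oner_eq0.
Qed.

(** The boundary of [s] is good and goodness is a linear condition, so two good faces force the
    third. *)
Lemma good_face (s : continuousType (D 2) X) (a b d : continuousType (D 1) X) :
  s \o face R o0 = a :> (D 1 -> X) ->
  s \o face R o1 = b :> (D 1 -> X) ->
  s \o face R o2 = d :> (D 1 -> X) ->
  (good (simplex_chain k b) -> good (simplex_chain k d) ->
    good (simplex_chain k a)) /\
  (good (simplex_chain k a) -> good (simplex_chain k d) ->
    good (simplex_chain k b)).
Proof.
move=> /(simplex_chain_eq k (s := s \o face R o0)) ea
  /(simplex_chain_eq k (s := s \o face R o1)) eb
  /(simplex_chain_eq k (s := s \o face R o2)) ed.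
have := good_boundary (simplex_chain k s).
rewrite boundary2 ea eb ed !linearD !linearN /=; split=> [hb hd|ha hd].
  by move: H; rewrite hb hd => /addIr /addIr.
by move: H; rewrite ha hd => /addIr /addrI /oppr_inj.
Qed.

(** The cone with apex [x] over [s] has edges as its two other faces. *)
Lemma good_star (s : continuousType (D 1) X) x :
  (forall t, le x (s t)) -> good (simplex_chain k s).
Proof.
move=> xs; have [h _] := good_face (cone_face0 hX xs) (cone_face1 hX xs)
  (cone_face2 hX xs).
by apply: h; exact: good_edge.
Qed.

(** By a Lebesgue number, short pieces of the path stay above one of its values, where [good_star]
    applies; they are then added one at a time. *)
Lemma good_simplex (s : continuousType (D 1) X) : good (simplex_chain k s).
Proof.
have [e e0 he] := @simplex_lebesgue R 1 (fun x => [set y | le (s x) (s y)])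
  (alex_near hX s).
have [N hN] : exists N : nat, 2 / N.+1%:R < e :> R.
  exists (Num.truncn (2 / e)).
  by rewrite ltr_pdivrMr ?ltr0Sn // mulrC -ltr_pdivrMr // truncnS_gt.
suff h (i : nat) : good (simplex_chain k (affine hX s 1 [:: 0; i%:R / N.+1%:R])).
  have E : N.+1%:R / N.+1%:R = 1 :> R by rewrite divff ?pnatr_eq0.
  by have := h N.+1; rewrite E (simplex_chain_eq k (affine01 hX s)); exact.
elim: i => [|i ih].
  rewrite mul0r; apply: (@good_star _ (s (seg_pt 0))) => t.
  have [r /andP[r0 r1] ->] := affine_between hX s t (lexx 0).
  have -> : r = 0 by apply/eqP; rewrite eq_le r1.
  exact: alex_refl.
set a := i%:R / _ in ih; set b := _ / _.
have ab : b - a = 1 / N.+1%:R by rewrite /a /b -mulrBl -natr1 addrAC subrr add0r.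
have ab0 : a <= b by rewrite -subr_ge0 ab divr_ge0.
(* A flat triangle: its faces are the new piece and the initial pieces up to [b] and up to [a]. *)
have [_ h] := good_face (affine_face0 hX s 0 a b) (affine_face1 hX s 0 a b)
  (affine_face2 hX s 0 a b).
refine (h _ ih); have [z hz] := he (seg_pt a).
apply: (@good_star _ (s z)) => t.
have [r /andP[ra rb] ->] := affine_between hX s t ab0.
apply: hz; apply: le_lt_trans (mix_lip _ _ _ _) _.
apply: le_lt_trans hN; rewrite distrC ger0_norm ?subr_ge0 //.
by rewrite -[2 / _]mulrC ler_wpM2r // -[X in _ <= X]mul1r -ab lerB.
Qed.

Lemma chain_normal_form z : good z.
Proof.
by move: z; apply: malg_linear_ext; exact: good_simplex.
Qed.

Lemma cycle_class z : boundary k R X 0 z = 0 -> pi z = L (integral z).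
Proof.
move=> hz; rewrite chain_normal_form.
rewrite -[LHS]/(L (integral _) + endpoint_class (boundary k R X 0 _)).
by rewrite hz linear0 addr0.
Qed.

End Cochain.

Section HomologyIntegral.
Variables (k : fieldType) (R : realType) (X : topologicalType).
Variables (le : X -> X -> Prop) (V : lmodType k) (c : X -> X -> V).
Hypothesis hX : alexandrov_for le.
Hypothesis hc : cocycle le c.
Local Notation pi := (chain_pi k R X).
Local Notation integral := (integral R hX hc).

Definition homology_integral (q : homology k R X 1) : V :=
  integral (cycle_val
    (repr (q : Quotient.quot (submod_pred (@bound_pred k R X 1))))).

Lemma homology_integral_pi z :
  homology_integral (lmod_pi (@bound_pred k R X 1) z) = integral (cycle_val z).
Proof.
rewrite /homology_integral; set z' := repr _.
have /lmod_piP : lmod_pi (@bound_pred k R X 1) z' = lmod_pi (@bound_pred k R X 1) z.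
  by rewrite /lmod_pi reprK.
rewrite unfold_in => /asboolP[w e]; apply/eqP; rewrite -subr_eq0 -linearB.
by rewrite -[_ - _]/(cycle_val (z' - z)) e integral_boundary.
Qed.

Lemma homology_integral_linear a u v :
  homology_integral (a *: u + v) = a *: homology_integral u + homology_integral v.
Proof.
elim/lmod_pi_ind: u => u; elim/lmod_pi_ind: v => v.
by rewrite -linearP !homology_integral_pi -linearP.
Qed.

Variables (L : {linear V -> chain_quot k R X}) (th : X -> chain_quot k R X).
Hypothesis edge_class : forall x y (h : le x y),
  pi (simplex_chain k (edge R hX h)) = L (c x y) + th y - th x.
Variable loop : V -> chain k R X 1.
Hypothesis loop_cycle : forall v, boundary k R X 0 (loop v) = 0.
Hypothesis loop_integral : forall v, integral (loop v) = v.

Lemma homology_integral_inj u : homology_integral u = 0 -> u = 0.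
Proof.
elim/lmod_pi_ind: u => z; rewrite homology_integral_pi => z0.
have := cycle_valP z; rewrite unfold_in => /asboolP hz.
have := cycle_class hc edge_class hz.
rewrite z0 linear0 -(linear0 pi) => /chain_piP[w]; rewrite subr0 => e.
rewrite -(linear0 (lmod_pi (@bound_pred k R X 1))); apply/lmod_piP.
by rewrite unfold_in; apply/asboolP; exists w; rewrite subr0.
Qed.

Lemma homology_integral_surj v : exists u, homology_integral u = v.
Proof.
have lP : loop v \in @cycle_pred k R X 1 by rewrite unfold_in; apply/asboolP.
exists (lmod_pi (@bound_pred k R X 1) (Cycle lP)).
by rewrite homology_integral_pi loop_integral.
Qed.

End HomologyIntegral.

Section HomologyIntegralNatural.
Variables (k : fieldType) (R : realType) (X Y : topologicalType).
Variables (leX : X -> X -> Prop) (leY : Y -> Y -> Prop) (V W : lmodType k).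
Variables (cX : X -> X -> V) (cY : Y -> Y -> W).
Hypotheses (hX : alexandrov_for leX) (hY : alexandrov_for leY).
Hypotheses (hcX : cocycle leX cX) (hcY : cocycle leY cY).
Variables (f : continuousType X Y) (phi : {linear V -> W}).
Hypothesis cf : forall x y, leX x y -> cY (f x) (f y) = phi (cX x y).

(** [phi] composed with a primitive along a path is a primitive along its image. *)
Lemma integral_chain_map z :
  integral R hY hcY (chain_map k R f 1 z) = phi (integral R hX hcX z).
Proof.
move: z; apply: (malg_linear_ext (f := integral R hY hcY \o chain_map k R f 1)
  (g := phi \o integral R hX hcX)) => s /=.
rewrite chain_mapU scale1r -!/(simplex_chain k _) !integralE.
have [u hu] := exists_path_primitive hX hcX s.
rewrite (path_integralE hX hcX hu) linearB.
rewrite (path_integralE hY hcY (u := phi \o u)) => [|x]; first by [].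
apply: filterS2 (hu x) (alex_near hX s x) => y /= -> xy.
by rewrite linearD cf.
Qed.

Lemma homology_integral_natural u :
  homology_integral hY hcY (homology_map k R f 1 u) =
  phi (homology_integral hX hcX u).
Proof.
elim/lmod_pi_ind: u => z; rewrite homology_map_pi !homology_integral_pi.
exact: integral_chain_map.
Qed.

End HomologyIntegralNatural.

(** * Realization of a diagram of vector spaces *)

Section PosetDiagram.
Variables (k : fieldType) (P : Type).

Record poset_diagram := PosetDiagram {
  pd_le : P -> P -> bool;
  pd_refl : forall p, pd_le p p;
  pd_trans : forall p q r, pd_le p q -> pd_le q r -> pd_le p r;
  pd_obj :> P -> lmodType k;
  pd_map : forall p q, pd_le p q -> {linear pd_obj p -> pd_obj q};
  pd_id : forall p (h : pd_le p p) u, pd_map h u = u;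
  pd_comp : forall p q r (hpq : pd_le p q) (hqr : pd_le q r) (hpr : pd_le p r) u,
    pd_map hqr (pd_map hpq u) = pd_map hpr u }.

Variable V : poset_diagram.

(* A simplex with the colours [nd_base] and [nd_sup] and the vertex [nd_wt i] of
   [V nd_gr] in colour [i].  Weights outside the colours are junk, and simplices
   that differ by a translation are equivalent for [node_le]. *)
Record node := Node {
  nd_gr : P;
  nd_base : 'I_3;
  nd_sup : {set 'I_3};
  nd_wt : 'I_3 -> V nd_gr }.

Definition nd_supp (t : node) : {set 'I_3} := nd_base t |: nd_sup t.

(** After transport to the grade of [t'], [t] is a face of [t'] up to one translation: the
    displacement is the same in every colour of [t]. *)
Definition node_le (t t' : node) : Prop :=
  exists h : pd_le V (nd_gr t) (nd_gr t'), nd_supp t \subset nd_supp t' /\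
    forall i, i \in nd_supp t ->
      nd_wt t' i - pd_map h (nd_wt t i) =
      nd_wt t' (nd_base t) - pd_map h (nd_wt t (nd_base t)).

Lemma base_supp t : nd_base t \in nd_supp t.
Proof. exact: finset.setU11. Qed.

Lemma pd_mapB p q (h : pd_le V p q) u v :
  pd_map h (u - v) = pd_map h u - pd_map h v.
Proof. exact: linearB. Qed.

Lemma node_le_refl t : node_le t t.
Proof.
exists (pd_refl V (nd_gr t)); split=> // i _; rewrite !pd_id !subrr; by [].
Qed.

Lemma node_le_trans x y z : node_le x y -> node_le y z -> node_le x z.
Proof.
move=> [h [xy e]] [h' [yz e']]; exists (pd_trans h h').
split=> [|i xi]; first exact: fintype.subset_trans yz.
have E j : nd_wt z j - pd_map (pd_trans h h') (nd_wt x j) =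
    nd_wt z j - pd_map h' (nd_wt y j) +
    pd_map h' (nd_wt y j - pd_map h (nd_wt x j)).
  rewrite pd_mapB (pd_comp _ _ (pd_trans h h')); zmod.
rewrite !E (e i xi) (e' _ (fintype.subsetP xy _ xi)).
by rewrite (e' _ (fintype.subsetP xy _ (base_supp x))).
Qed.

Definition node_preorder : preorder node := Preorder node_le_refl node_le_trans.

(** * Homology of the part below a grade *)

Section Down.
Variables (R : realType) (X : topologicalType) (nd : X -> node) (p : P).
Local Notation le := (fun x y : X => node_le (nd x) (nd y)).
Hypothesis hX : alexandrov_for le.
Hypothesis gr_le : forall x, pd_le V (nd_gr (nd x)) p.

Definition top_wt x i : V p := pd_map (gr_le x) (nd_wt (nd x) i).

(* The difference between the base vertices of [x] and [y], both being vertices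
   of [y]. *)
Definition node_cocycle x y : V p :=
  top_wt y (nd_base (nd x)) - top_wt y (nd_base (nd y)).

Lemma top_wt_le x y i : le x y -> i \in nd_supp (nd x) ->
  top_wt y i - top_wt x i =
  top_wt y (nd_base (nd x)) - top_wt x (nd_base (nd x)).
Proof.
move=> [h [_ e]] xi; have E j : top_wt y j - top_wt x j =
    pd_map (gr_le y) (nd_wt (nd y) j - pd_map h (nd_wt (nd x) j)).
  by rewrite linearB (pd_comp _ _ (gr_le x)).
by rewrite !E e.
Qed.

(** The base colours of [x] and [y] both occur in [y], so passing from [y] to [z] displaces both
    vertices by the same vector. *)
Lemma node_cocycleP : cocycle le node_cocycle.
Proof.
move=> x y z xy yz; rewrite /node_cocycle.
have [h [sub _]] := xy.
have := top_wt_le yz (fintype.subsetP sub _ (base_supp (nd x))).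
move=> /eqP; rewrite subr_eq => /eqP ->.
zmod.
Qed.

Variable mk : node -> X.
Hypothesis mkK : forall t, pd_le V (nd_gr t) p -> nd (mk t) = t.

Definition top_node b S (w : 'I_3 -> V p) : X := mk (@Node p b S w).

Lemma nd_top b S w : nd (top_node b S w) = @Node p b S w.
Proof. by rewrite mkK //= pd_refl. Qed.

(** A monotone map above the identity, hence a homotopy into the elements of grade [p]. *)
Definition push x : X := top_node (nd_base (nd x)) (nd_sup (nd x)) (top_wt x).

Lemma top_wt_top b S w i : top_wt (top_node b S w) i = w i.
Proof.
rewrite /top_wt; move: (gr_le _); rewrite nd_top => h; exact: pd_id.
Qed.

Lemma node_cocycle_top x b S w :
  node_cocycle x (top_node b S w) = w (nd_base (nd x)) - w b.
Proof. by rewrite /node_cocycle !top_wt_top nd_top. Qed.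

Lemma le_push x : le x (push x).
Proof.
rewrite /push nd_top; exists (gr_le x); split=> // i _.
by rewrite /= /top_wt !subrr.
Qed.

Lemma push_mono x y : le x y -> le (push x) (push y).
Proof.
move=> xy; have [h [sub e]] := xy; rewrite /push !nd_top.
exists (pd_refl V p); split=> //= i xi; rewrite !pd_id.
exact: top_wt_le.
Qed.

(** Modulo translation, grade [p] has one vertex of each colour, and one edge between two given
    colours for each difference [v]. *)
Definition vert i : X := top_node i finset.set0 (fun=> 0).
Definition segm i j v : X :=
  top_node i [set j] (fun l => if l == i then 0 else v).

Lemma vert_le i b S w : i \in b |: S -> le (vert i) (top_node b S w).
Proof.
rewrite /vert !nd_top => iS; exists (pd_refl V p); split.
  by rewrite /nd_supp /= finset.setU0 finset.sub1set.
by move=> l; rewrite /nd_supp /= finset.setU0 finset.inE => /eqP ->.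
Qed.

Lemma segm_le i j v b S w : i \in b |: S -> j \in b |: S -> v = w j - w i ->
  le (segm i j v) (top_node b S w).
Proof.
rewrite /segm !nd_top => iS jS ev; exists (pd_refl V p); split.
  by rewrite /nd_supp /= finset.subUset !finset.sub1set iS.
move=> l; rewrite /nd_supp /= !finset.inE !pd_id eqxx subr0 => /orP[/eqP ->|/eqP ->].
  by rewrite eqxx subr0.
by case: eqP => [->|_]; rewrite ?subr0 // ev opprB addrC subrK.
Qed.

Lemma vert_segm_l i j v : le (vert i) (segm i j v).
Proof. by apply: vert_le; rewrite finset.setU11. Qed.

Lemma vert_segm_r i j v : le (vert j) (segm i j v).
Proof. by apply: vert_le; rewrite !finset.inE eqxx orbT. Qed.

Definition edge_chain x y : chain k R X 1 :=
  if pselect (le x y) is left h then simplex_chain k (edge R hX h) else 0.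

Local Notation pi := (chain_pi k R X).
Definition ed x y : chain_quot k R X := pi (edge_chain x y).

Lemma edE x y (h : le x y) : ed x y = pi (simplex_chain k (edge R hX h)).
Proof.
rewrite /ed /edge_chain; case: pselect => // h'.
by congr (pi (simplex_chain k _)); apply/continuousEP.
Qed.

(** The cone with apex [x] over the edge from [y] to [z] fills the triangle. *)
Lemma ed_tri x y z : le x y -> le y z -> ed x z = ed x y + ed y z.
Proof.
move=> xy yz; have xz := hX.2 _ _ _ xy yz.
have xs (t : simplex R 1) : le x (edge R hX yz t).
  by rewrite /= /mkcts; case: ifP.
have := chain_pi2 k (cone hX xs).
rewrite (simplex_chain_eq k (cone_face0 hX xs)).
rewrite (simplex_chain_eq k (cone_face1 hX xs)).
rewrite (simplex_chain_eq k (cone_face2 hX xs)).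
rewrite -!edE.
by rewrite /= /mkcts /bary /= !mxE /= eqxx eq_sym oner_eq0.
Qed.

(** In the barycentric subdivision, an edge of the complex climbs to its midpoint [segm i j v] and
    descends to the other end. *)
Definition arc i j v : chain_quot k R X :=
  ed (vert i) (segm i j v) - ed (vert j) (segm i j v).

(** Any simplex that contains the edge can replace its midpoint as the top of the arc. *)
Lemma arcE i j v b S w : i \in b |: S -> j \in b |: S -> v = w j - w i ->
  arc i j v = ed (vert i) (top_node b S w) - ed (vert j) (top_node b S w).
Proof.
move=> iS jS ev; have h := segm_le iS jS ev.
rewrite (ed_tri (vert_segm_l i j v) h) (ed_tri (vert_segm_r i j v) h) /arc.
zmod.
Qed.

Lemma arc_refl i : arc i i 0 = 0.
Proof. by rewrite /arc subrr. Qed.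

Lemma arcD i j l a b : i != j -> j != l -> (i == l -> b = - a) ->
  arc i j a + arc j l b = arc i l (a + b).
Proof.
move=> ij jl il.
(* Vertices of a triangle containing both arcs; if [i] equals [l], it is one edge run forth and
   back. *)
pose w m : V p := if m == i then 0 else if m == j then a else a + b.
have wi : w i = 0 by rewrite /w eqxx.
have wj : w j = a by rewrite /w eq_sym (negbTE ij) eqxx.
have wl : w l = a + b.
  rewrite /w; have [li|_] := eqVneq l i; first by rewrite il ?subrr // li.
  by rewrite eq_sym (negbTE jl).
have inT m : m \in (ord0 : 'I_3) |: finset.setT by rewrite !finset.inE orbT.
rewrite (arcE (w := w) (inT i) (inT j)); last by rewrite wj wi subr0.
rewrite (arcE (w := w) (inT j) (inT l)); last by rewrite wj wl addrC addKr.
rewrite (arcE (w := w) (inT i) (inT l)); last by rewrite wi wl subr0.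
zmod.
Qed.

(* The loop through the colours 0, [i], [j] along edges labelled 0, [v], 0. *)
Definition circ i j v := arc ord0 i 0 + arc i j v - arc ord0 j 0.

Lemma circ_refl i : circ i i 0 = 0.
Proof. rewrite /circ arc_refl; zmod. Qed.

Lemma circD i j l a b : i != j -> j != l -> (i == l -> b = - a) ->
  circ i j a + circ j l b = circ i l (a + b).
Proof. move=> ij jl il; rewrite /circ -(arcD ij jl il); zmod. Qed.

Local Notation o1 := (lift ord0 ord0 : 'I_3).
Local Notation o2 := (lift ord0 (lift ord0 ord0) : 'I_3).

(** The sign makes the cocycle integrate to [v]: it integrates to [- v] along [arc i j v]. *)
Definition loop_class v := - circ ord0 o1 v.

Lemma circ0 j : circ ord0 j 0 = 0.
Proof. rewrite /circ arc_refl; zmod. Qed.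

(** The edges labelled 0 bound a triangle, so they can be added freely; this makes the three pairs
    of colours interchangeable. *)
Lemma circ12_0 : circ o1 o2 0 = 0.
Proof.
have := @circD ord0 o1 o2 0 0 isT isT (fun h => ltac:(by [])).
by rewrite !circ0 add0r addr0 circ0.
Qed.

Lemma circ02 v : circ ord0 o2 v = circ ord0 o1 v.
Proof.
have := @circD ord0 o1 o2 v 0 isT isT (fun h => ltac:(by [])).
by rewrite circ12_0 !addr0.
Qed.

Lemma circ12 v : circ o1 o2 v = circ ord0 o1 v.
Proof.
have := @circD ord0 o1 o2 0 v isT isT (fun h => ltac:(by [])).
by rewrite circ0 !add0r circ02.
Qed.

(** The triangle with edges labelled [u], [v], [u + v] gives the relation; it takes all three
    colours. *)
Lemma loop_classD u v : loop_class (u + v) = loop_class u + loop_class v.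
Proof.
rewrite /loop_class; have := @circD ord0 o1 o2 u v isT isT (fun h => ltac:(by [])).
rewrite circ02 circ12 => <-; zmod.
Qed.

Lemma loop_classN v : loop_class (- v) = - loop_class v.
Proof.
apply/eqP; rewrite -addr_eq0 -loop_classD addrC subrr /loop_class.
by rewrite circ0 oppr0.
Qed.

Lemma circE i j v : (i == j -> v = 0) -> circ i j v = - loop_class v.
Proof.
have lt_circ (a b : 'I_3) u : (a < b)%N -> circ a b u = - loop_class u.
  rewrite /loop_class opprK; case: a b => [[|[|[|//]]] ha] [[|[|[|//]]] hb] //= _;
    [|rewrite -circ02|rewrite -(circ12 u)]; congr circ; exact/val_inj.
move=> ij; case: (ltngtP i j) => h; first exact: lt_circ.
  have ne : i != j by apply: contraTneq h => ->; rewrite ltnn.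
  (* Running the edge from [j] to [i] and back reduces this to the case of increasing colours. *)
  have := @circD j i j (- v) v; rewrite eq_sym ne => /(_ isT isT (fun=> _)).
  rewrite opprK addNr circ_refl (lt_circ j i) // => /(_ erefl).
  by move=> /eqP; rewrite loop_classN opprK addr_eq0 => /eqP ->; rewrite opprK.
move/val_inj: h => h; rewrite h ij ?h // circ_refl.
by rewrite /loop_class opprK circ0.
Qed.

(** From [vert ord0] along an arc labelled 0 to the base colour of [x], up to [push x], down to
    [x]. *)
Definition base_path x : chain_quot k R X :=
  arc ord0 (nd_base (nd x)) 0 + ed (vert (nd_base (nd x))) (push x) - ed x (push x).

(* [x <= y <= push y] and [x <= push x <= push y] reduce the edge to grade [p],
   where it is homologous to the arc between the base colours. *)
Lemma ed_class x y : le x y ->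
  ed x y = loop_class (node_cocycle x y) + base_path y - base_path x.
Proof.
move=> xy; have xx := le_push x; have yy := le_push y; have pp := push_mono xy.
have [_ [sub _]] := xy.
set b := nd_base (nd x); set b' := nd_base (nd y).
have bx : le (vert b) (push x) by apply: vert_le; exact: base_supp.
have b'S : b' \in b' |: nd_sup (nd y) by exact: finset.setU11.
have bS : b \in b' |: nd_sup (nd y) := fintype.subsetP sub _ (base_supp (nd x)).
(* The arc runs from [b'] to [b], so that its label is exactly [node_cocycle x y]. *)
have := arcE (w := top_wt y) b'S bS erefl.
rewrite -/(node_cocycle x y) -/(push y) => ea.
have := @circE b' b (node_cocycle x y); rewrite /circ ea => ec.
have -> : loop_class (node_cocycle x y) =
    - (arc ord0 b' 0 + (ed (vert b') (push y) - ed (vert b) (push y)) -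
       arc ord0 b 0).
  rewrite ec ?opprK // /node_cocycle -/b -/b' => /eqP ->; exact: subrr.
rewrite /base_path -/b -/b'.
have := ed_tri xy yy; rewrite (ed_tri xx pp) (ed_tri bx pp).
move=> /eqP; rewrite -subr_eq => /eqP <-; zmod.
Qed.

(** An explicit chain of class [loop_class v], on which the cycle condition and the integral can be
    evaluated. *)
Definition loop_chain v : chain k R X 1 :=
  edge_chain (vert o1) (segm ord0 o1 v) - edge_chain (vert ord0) (segm ord0 o1 v)
  + edge_chain (vert ord0) (segm ord0 o1 0) - edge_chain (vert o1) (segm ord0 o1 0).

Definition pt_chain x : chain k R X 0 :=
  simplex_chain k (@mkcts _ _ (cst x) (@cst_continuous _ _ x)).

Lemma boundary_edge_chain x y : le x y ->
  boundary k R X 0 (edge_chain x y) = pt_chain y - pt_chain x.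
Proof.
move=> xy; rewrite /edge_chain; case: pselect => // h; rewrite boundary1.
congr (_ - _); apply: simplex_chain_eq; apply/funext => s; rewrite /= /mkcts.
  by have [-> _] := bary_face0 s; rewrite eq_sym oner_eq0.
have -> : bary (face R (lift ord0 ord0) s) ord0 ord0 = 1.
  rewrite bary_face.
  have -> : (ord0 : 'I_2) = lift (lift ord0 ord0) ord0 by apply/val_inj.
  rewrite liftK /=; have := simplex_sum s.
  by rewrite big_ord_recl big_ord0 addr0.
by rewrite eqxx.
Qed.

Lemma loop_chain_cycle v : boundary k R X 0 (loop_chain v) = 0.
Proof.
rewrite /loop_chain !(linearB, linearD) /= !boundary_edge_chain.
- zmod.
all: by [exact: vert_segm_l | exact: vert_segm_r].
Qed.

Lemma integral_edge_chain x y : le x y ->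
  integral R hX node_cocycleP (edge_chain x y) = node_cocycle x y.
Proof.
by move=> xy; rewrite /edge_chain; case: pselect => // h; rewrite integral_edge.
Qed.

Lemma loop_chain_integral v :
  integral R hX node_cocycleP (loop_chain v) = v.
Proof.
rewrite /loop_chain !(linearB, linearD) /= !integral_edge_chain;
  try by [exact: vert_segm_l | exact: vert_segm_r].
rewrite /vert /segm !node_cocycle_top !nd_top /=; zmod.
Qed.

End Down.
End PosetDiagram.

(* Over prime fields, the tensor product over Z is the one over [k]. *)
Definition additive_scalable (k : fieldType) := forall (U W : lmodType k) (f : U -> W),
  {morph f : u v / u + v} -> forall a u, f (a *: u) = a *: f u.

Lemma morph_natmul (U W : zmodType) (f : U -> W) : {morph f : u v / u + v} ->
  forall u n, f (u *+ n) = f u *+ n.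
Proof.
move=> fD u; have f0 : f 0 = 0.
  by have /eqP := fD 0 0; rewrite addr0 eq_sym -subr_eq0 addrK => /eqP.
by elim=> [|n ih]; rewrite ?mulr0n // !mulrS fD ih.
Qed.

Lemma Fp_additive_scalable (p : nat) : additive_scalable 'F_p.
Proof.
move=> U W f fD a u; rewrite -[a]natr_Zp !scaler_nat.
exact: morph_natmul.
Qed.

(** Additive maps respect integer multiples, and multiplication by the denominator of [a] is
    injective. *)
Lemma rat_additive_scalable : additive_scalable rat.
Proof.
move=> U W f fD a u.
have fN v : f (- v) = - f v.
  apply/eqP; rewrite -addr_eq0 -fD addNr.
  by have := morph_natmul fD v 0; rewrite !mulr0n => ->.
have fZ (m : int) v : f (m%:~R *: v) = m%:~R *: f v.
  rewrite !scaler_int; case: m => m; rewrite ?NegzE -?pmulrn.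
    exact: morph_natmul.
  by rewrite !mulrNz fN -!pmulrn morph_natmul.
have d0 : (denq a)%:~R != 0 :> rat by rewrite intr_eq0 denq_eq0.
apply: (@scalerI _ _ (denq a)%:~R) => //.
have e : (denq a)%:~R * a = (numq a)%:~R by rewrite mulrC numqE.
rewrite -fZ !scalerA e.
exact: fZ.
Qed.

Section DownHomology.
Variables (k : fieldType) (P : Type) (V : poset_diagram k P).
Variables (R : realType) (X : topologicalType) (nd : X -> node V) (p : P).
Local Notation le := (fun x y : X => node_le (nd x) (nd y)).
Hypothesis hX : alexandrov_for le.
Hypothesis gr_le : forall x, pd_le V (nd_gr (nd x)) p.
Variable mk : node V -> X.
Hypothesis mkK : forall t, pd_le V (nd_gr t) p -> nd (mk t) = t.
Hypothesis kP : additive_scalable k.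

Local Notation hint := (@homology_integral k R X le (V p) _ hX (node_cocycleP gr_le)).

Lemma node_homology_bij :
  (forall u, hint u = 0 -> u = 0) /\ (forall v, exists u, hint u = v).
Proof.
(* The triangles give only additivity; [kP] upgrades it to linearity. *)
have lin : linear (@loop_class k P V R X nd p hX mk).
  move=> a u v; rewrite (loop_classD R hX mkK); congr (_ + _).
  by apply: kP => {}u {}v; exact: loop_classD.
pose L : {linear V p -> chain_quot k R X} :=
  HB.pack (@loop_class k P V R X nd p hX mk) (GRing.isLinear.Build _ _ _ _ _ lin).
split.
  apply: (homology_integral_inj (L := L) (th := base_path R hX gr_le mk)).
  move=> x y h; rewrite -edE; exact: ed_class.
apply: (homology_integral_surj (loop := loop_chain R hX mk)).
  exact: loop_chain_cycle.
exact: loop_chain_integral.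
Qed.

End DownHomology.

Section NodeSublevel.
Variables (k : fieldType) (R : realType) (n : nat) (P : Type).
Variable V : poset_diagram k P.
Local Notation T := (alexandrov (node_preorder V) : topologicalType).
(* The sublevel sets of [g] are the principal down-sets of the [top a]. *)
Variables (g : T -> 'rV[R]_n) (top : 'rV[R]_n -> P).
Hypothesis gE : forall (t : T) a, lev (g t) a = pd_le V (nd_gr (t : node V)) (top a).
Hypothesis kP : additive_scalable k.

Local Notation nd := (fun x : sublevel g _ => (val x : node V)).

Lemma sublevel_alexandrov a :
  @alexandrov_for (sublevel g a) (fun x y => node_le (val x : node V) (val y)).
Proof.
split=> [x A|x y z]; last exact: node_le_trans.
split.
  case=> B /= [[W oW <-]] /= Wx WA y xy; apply: WA => /=.
  by move: oW; rewrite openE => /(_ _ Wx); apply.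
move=> h; have : nbhs (val x : T) [set t | node_le (val x : node V) t] by [].
move=> /(@initial_continuous _ _ (set_val : sublevel g a -> T) x).
by apply: (@filterS (sublevel g a)) => y; exact: h.
Qed.

Lemma sublevel_gr a (x : sublevel g a) : pd_le V (nd_gr (val x : node V)) (top a).
Proof. by rewrite -gE; exact: set_valP x. Qed.

Definition sublevel_integral a (u : homology k R (sublevel g a) 1) : V (top a) :=
  homology_integral (sublevel_alexandrov a) (node_cocycleP (@sublevel_gr a)) u.

Lemma sublevel_integral_linear a c u v :
  sublevel_integral (a := a) (c *: u + v) =
  c *: sublevel_integral u + sublevel_integral v.
Proof. exact: homology_integral_linear. Qed.

Lemma sublevel_integral_bij a :
  (forall u, sublevel_integral (a := a) u = 0 -> u = 0) /\
  (forall v, exists u, sublevel_integral (a := a) u = v).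
Proof.
pose t0 : T := @Node k P V (top a) ord0 finset.set0 (fun=> 0).
have t0P : t0 \in sublevel_set g a.
  by apply/mem_set; rewrite /sublevel_set /= gE /=; exact: pd_refl.
(* Nodes outside the sublevel set are sent to the junk value [t0]. *)
pose mk (t : node V) : sublevel g a :=
  if pselect ((t : T) \in sublevel_set g a) is left h
  then exist (fun y => is_true (y \in sublevel_set g a)) (t : T) h
  else exist (fun y => is_true (y \in sublevel_set g a)) t0 t0P.
apply: (@node_homology_bij k P V R (sublevel g a) _ (top a) (sublevel_alexandrov a)
  (@sublevel_gr a) mk) => // t ht.
rewrite /mk; case: pselect => // h; exfalso; apply: h.
by apply/mem_set; rewrite /sublevel_set /= gE.
Qed.

Lemma sublevel_integral_natural a b (h : lev a b) (h' : pd_le V (top a) (top b)) u :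
  sublevel_integral (homology_map k R (sublevel_incl g h) 1 u) =
  pd_map h' (sublevel_integral u).
Proof.
apply: homology_integral_natural => x y xy.
rewrite /node_cocycle pd_mapB /top_wt.
by rewrite !(pd_comp _ h' (sublevel_gr (sublevel_incl g h y))).
Qed.

End NodeSublevel.

(** * Graded modules and diagrams *)

Section Constants.
Variables (k : fieldType) (R : realType) (n : nat).
Local Notation B := (monoid_ring k R n).

Definition const_mono (c : k) : B := mkmalgU (nnvec0 R n) c.

Lemma const_monoM c d : const_mono (c * d) = const_mono c * const_mono d.
Proof.
have e : mmul (nnvec0 R n) (nnvec0 R n) = nnvec0 R n := nnvec_add0 _.
by rewrite /const_mono malgM_def fgmulUU e.
Qed.

Lemma const_monoD c d : const_mono (c + d) = const_mono c + const_mono d.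
Proof. exact: monalgUD. Qed.

Lemma const_mono1 : const_mono 1 = 1. Proof. by []. Qed.

Lemma const_mono0 : const_mono 0 = 0.
Proof. exact: monalgU0. Qed.

Lemma const_monoN1 : const_mono (-1) = -1.
Proof.
by apply/eqP; rewrite -subr_eq0 opprK -const_mono1 -const_monoD addNr const_mono0.
Qed.

Lemma mkmalgU_xpow (x : nnvec R n) c : mkmalgU x c = const_mono c * xpow k x :> B.
Proof.
have e : mmul (nnvec0 R n) x = x := nnvec_add0 _.
by rewrite /const_mono /xpow malgM_def fgmulUU mulr1 e.
Qed.

End Constants.
Arguments const_mono {k R n} c.

Section GradedPiece.
Variables (k : fieldType) (R : realType) (n : nat) (M : pmodule k R n) (a : 'rV[R]_n).

Record graded_piece := GradedPiece {
  gp_val : M;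
  gp_valP : pm_gr a gp_val }.

Lemma gp_inj u v : gp_val u = gp_val v -> u = v.
Proof.
case: u v => u hu [v hv] /= e; case: _ / e hv => hv.
by congr GradedPiece; exact: Prop_irrelevance.
Qed.

HB.instance Definition _ := gen_eqMixin graded_piece.
HB.instance Definition _ := gen_choiceMixin graded_piece.

Lemma gr_opp (u : M) : pm_gr a u -> pm_gr a (- u).
Proof.
by move=> hu; rewrite -scaleN1r -const_monoN1; exact: pm_grZ.
Qed.

Definition gp_zero := GradedPiece (@pm_gr0 k R n M a).
Definition gp_opp u := GradedPiece (gr_opp (gp_valP u)).
Definition gp_add u v := GradedPiece (pm_grD (gp_valP u) (gp_valP v)).
Definition gp_scale c u := GradedPiece (pm_grZ c (gp_valP u)).

Lemma gp_addA : associative gp_add.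
Proof. by move=> u v w; apply: gp_inj; rewrite /= addrA. Qed.
Lemma gp_addC : commutative gp_add.
Proof. by move=> u v; apply: gp_inj; rewrite /= addrC. Qed.
Lemma gp_add0 : left_id gp_zero gp_add.
Proof. by move=> u; apply: gp_inj; rewrite /= add0r. Qed.
Lemma gp_addN : left_inverse gp_zero gp_opp gp_add.
Proof. by move=> u; apply: gp_inj; rewrite /= addNr. Qed.
HB.instance Definition _ := GRing.isZmodule.Build graded_piece
  gp_addA gp_addC gp_add0 gp_addN.

Lemma gp_scaleA c d u : gp_scale c (gp_scale d u) = gp_scale (c * d) u.
Proof. by apply: gp_inj; rewrite /= -!/(const_mono _) const_monoM scalerA. Qed.
Lemma gp_scale1 : left_id 1 gp_scale.
Proof. by move=> u; apply: gp_inj; rewrite /= scale1r. Qed.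
Lemma gp_scaleDr : right_distributive gp_scale +%R.
Proof. by move=> c u v; apply: gp_inj; rewrite /= scalerDr. Qed.
Lemma gp_scaleDl u : {morph gp_scale^~ u : c d / c + d}.
Proof.
by move=> c d; apply: gp_inj; rewrite /= -!/(const_mono _) const_monoD scalerDl.
Qed.
HB.instance Definition _ := GRing.Zmodule_isLmodule.Build k graded_piece
  gp_scaleA gp_scale1 gp_scaleDr gp_scaleDl.

Lemma gp_valP_linear c u v :
  gp_val (c *: u + v) = const_mono c *: gp_val u + gp_val v.
Proof. by []. Qed.

End GradedPiece.

Section PmIso.
Variables (k : fieldType) (R : realType) (n : nat).
Implicit Types M N : pmodule k R n.

Lemma gr_natmul M a (u : M) m : pm_gr a u -> pm_gr a (u *+ m).
Proof.
move=> hu; elim: m => [|m ih]; first by rewrite mulr0n; exact: pm_gr0.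
by rewrite mulrS; exact: pm_grD.
Qed.

Lemma pm_dec_uniq M (u : M) : exists (s : seq 'rV[R]_n) (h : 'rV[R]_n -> M),
  [/\ uniq s, forall a, pm_gr a (h a) & u = \sum_(a <- s) h a].
Proof.
have [s [h [hh ->]]] := pm_dec u.
(* A degree may be repeated in [s], so its component is taken with multiplicity. *)
exists (undup s), (fun a => h a *+ count_mem a s); split.
- exact: undup_uniq.
- by move=> a; exact: gr_natmul.
- by rewrite -big_undup_iterop_count.
Qed.

(** Subtracting the whole sum in degree [a] gives a vanishing sum of homogeneous terms, to which
    [pm_ind] applies. *)
Lemma gr_unique M a (s : seq 'rV[R]_n) (h : 'rV[R]_n -> M) : uniq s ->
  (forall b, pm_gr b (h b)) -> pm_gr a (\sum_(b <- s) h b) ->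
  forall b, b \in s -> b != a -> h b = 0.
Proof.
move=> us hh hsum b bs ba; pose t := if a \in s then s else a :: s.
have ut : uniq t by rewrite /t; case: ifP => //= ->.
have at_ : a \in t by rewrite /t; case: ifP => // _; rewrite mem_head.
have st c : c \in s -> c \in t.
  by rewrite /t; case: ifP => // _; rewrite inE => ->; rewrite orbT.
pose h0 c := if c \in s then h c else 0.
have h0E : \sum_(c <- t) h0 c = \sum_(c <- s) h c.
  rewrite /t /h0; case: ifP => [_|as_].
    by apply: eq_big_seq => c ->.
  by rewrite big_cons as_ add0r; apply: eq_big_seq => c ->.
pose h' c := if c == a then h0 c - \sum_(b <- s) h b else h0 c.
have h0_gr c : pm_gr c (h0 c) by rewrite /h0; case: ifP => // _; exact: pm_gr0.
have h'_gr c : pm_gr c (h' c).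
  rewrite /h'; case: eqP => // ->; apply: pm_grD; first exact: h0_gr.
  exact: gr_opp.
have h'0 : \sum_(c <- t) h' c = 0.
  rewrite (bigD1_seq a) //= {1}/h' eqxx addrAC.
  rewrite (eq_bigr h0); last by move=> c /negbTE ca; rewrite /h' ca.
  by rewrite -(bigD1_seq a (F := h0)) //= h0E subrr.
have := pm_ind ut h'_gr h'0 (st b bs).
by rewrite /h' (negbTE ba) /h0 bs.
Qed.

(** The inverse respects degrees: if [v] has degree [a], then [f] kills the components of [g v] in
    all other degrees. *)
Lemma pm_iso_bij M N (f : pm_hom M N) : (forall u, f u = 0 -> u = 0) ->
  (forall v, exists u, f u = v) -> pm_iso M N.
Proof.
move=> finj /choice[g fg].
have f_inj : injective f.
  by move=> u v e; apply/eqP; rewrite -subr_eq0; apply/eqP/finj; rewrite linearB /= e subrr.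
have gf : cancel f g by move=> u; apply: f_inj; rewrite fg.
have glin : linear g by move=> c u v; apply: f_inj; rewrite linearP /= !fg.
pose G : {linear N -> M} := HB.pack g (GRing.isLinear.Build _ _ _ _ g glin).
have G_gr a v : pm_gr a v -> pm_gr a (G v).
  move=> hv; have [s [h [us hh e]]] := pm_dec_uniq (g v).
  have e' : v = \sum_(b <- s) f (h b) by rewrite -(fg v) e linear_sum.
  rewrite /= e; have h0 b : b \in s -> b != a -> h b = 0.
    move=> bs ba; apply: finj.
    apply: (gr_unique (h := fun b => f (h b)) us _ _ bs ba).
      by move=> c; exact: pmh_gr.
    by rewrite -e'.
  have [as_|as_] := boolP (a \in s).
    rewrite (bigD1_seq a) //= big1_seq ?addr0 // => b /andP[ba bs].
    exact: h0.
  rewrite big1_seq; first exact: pm_gr0.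
  by move=> b /andP[_ bs]; apply: h0 => //; apply: contraNneq as_ => <-.
by exists f, (PMHom G_gr); split.
Qed.

End PmIso.

Section DiagramModule.
Variables (k : fieldType) (R : realType) (n : nat) (D : diagram k R n).
Local Notation B := (monoid_ring k R n).
Local Notation W := (dsum D).

(** Constants and monomials generate the monoid ring, so linearity need only be tested on them. *)
Lemma dg_car_linear (N : lmodType B) (F : W -> N) :
  {morph F : u v / u + v} ->
  (forall (c : k) u, F (c *: u) = const_mono c *: F u) ->
  (forall x u, F (dg_shift x u) = xpow k x *: F u) ->
  linear (F : dg_car D -> N).
Proof.
move=> FD FZ FX b u v; rewrite -[LHS]/(F ((b *: u : dg_car D) + v : W)) FD.
congr (_ + _); have F0 : F 0 = 0 by rewrite -(scale0r 0) FZ const_mono0 scale0r.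
have Fsum (s : seq (nnvec R n)) (h : nnvec R n -> W) :
    F (\sum_(x <- s) h x) = \sum_(x <- s) F (h x).
  by elim: s => [|x s ih]; rewrite ?big_nil // !big_cons FD ih.
rewrite [in RHS](monalgE b) scaler_suml.
rewrite -[LHS]/(F (\sum_(x <- finmap.enum_fset (msupp b))
                     mcoeff x b *: dg_shift x u)) Fsum.
by apply: eq_bigr => x _; rewrite FZ FX mkmalgU_xpow scalerA.
Qed.

Variables (M : pmodule k R n) (alpha : forall a, D a -> M).
Hypothesis alpha_gr : forall a u, pm_gr a (alpha (a := a) u).
Hypothesis alpha_lin : forall a c u v,
  alpha (a := a) (c *: u + v) = const_mono c *: alpha u + alpha v.
Hypothesis alpha_inj : forall a u, alpha (a := a) u = 0 -> u = 0.
Hypothesis alpha_surj : forall a v, pm_gr a v -> exists u, alpha (a := a) u = v.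
Hypothesis alpha_nat : forall a b (h : lev a b) u,
  alpha (dg_map D h u) = transition h (alpha u).

Lemma alpha0 a : alpha (0 : D a) = 0.
Proof.
have := alpha_lin (-1 : k) (0 : D a) 0.
by rewrite scaler0 addr0 const_monoN1 scaleN1r addNr.
Qed.

Definition dsum_map (u : W) : M :=
  \sum_(a <- undup (projT1 (cid (dsfinP u)))) alpha (u a).

Lemma dsum_mapE (u : W) s : uniq s -> (forall a, a \notin s -> u a = 0) ->
  dsum_map u = \sum_(a <- s) alpha (u a).
Proof.
rewrite /dsum_map; case: cid => t /= ht us hs.
have sum_incl (r r' : seq 'rV[R]_n) : uniq r -> uniq r' ->
    (forall a, a \notin r -> u a = 0) -> 
    \sum_(a <- r') alpha (u a) = \sum_(a <- [seq a <- r' | a \in r]) alpha (u a).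
  move=> ur ur' hr; rewrite big_filter [RHS]big_mkcond; apply: eq_bigr => a _.
  by case: ifP => // /negbT /hr ->; exact: alpha0.
have ht' a : a \notin undup t -> u a = 0 by rewrite mem_undup; exact: ht.
rewrite (sum_incl s) ?undup_uniq // [RHS](sum_incl (undup t)) ?undup_uniq //.
apply: perm_big; apply: uniq_perm; rewrite ?filter_uniq ?undup_uniq // => a.
by rewrite !mem_filter andbC.
Qed.

Lemma dsum_mapD : {morph dsum_map : u v / u + v}.
Proof.
move=> u v; have [s hs] := dsfinP u; have [t ht] := dsfinP v.
pose r := undup (s ++ t).
have hr a : a \notin r -> u a = 0 /\ v a = 0.
  by rewrite mem_undup mem_cat negb_or => /andP[/hs -> /ht ->].
rewrite !(@dsum_mapE _ r) ?undup_uniq //.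
- rewrite -big_split; apply: eq_bigr => a _; rewrite dsumD.
  by have := alpha_lin 1 (u a) (v a); rewrite scale1r const_mono1 scale1r.
- by move=> a /hr[].
- by move=> a /hr[].
- by move=> a /hr[ua va]; rewrite dsumD ua va addr0.
Qed.

Lemma dsum_mapZ (c : k) u : dsum_map (c *: u) = const_mono c *: dsum_map u.
Proof.
have [s hs] := dsfinP u.
have hs' a : a \notin undup s -> u a = 0 by rewrite mem_undup; exact: hs.
rewrite !(@dsum_mapE _ (undup s)) ?undup_uniq //.
  rewrite scaler_sumr; apply: eq_bigr => a _; rewrite dsumZ.
  by have := alpha_lin c (u a) 0; rewrite alpha0 !addr0.
by move=> a /hs' ua; rewrite dsumZ ua scaler0.
Qed.

Lemma dsum_mapX x u : dsum_map (dg_shift x u) = xpow k x *: dsum_map u.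
Proof.
have [s hs] := dsfinP u.
have hs' a : a \notin undup s -> u a = 0 by rewrite mem_undup; exact: hs.
rewrite (@dsum_mapE u (undup s)) ?undup_uniq //.
rewrite (@dsum_mapE _ [seq a + nnval x | a <- undup s]).
- rewrite big_map scaler_sumr; apply: eq_bigr => a _.
  rewrite /= /dg_shift_fun.
  have h : lev a (a + nnval x).
    by apply/forallP => i; rewrite !mxE lerDl nnvec_ge0.
  rewrite (dg_map_eq (addrK _ _) _ h) alpha_nat /transition.
  have -> // : nnsub h = x by apply/val_inj; rewrite /= addrC addKr.
- by rewrite map_inj_uniq ?undup_uniq // => a b /addIr.
- move=> a ha; rewrite /= /dg_shift_fun hs' ?linear0 //.
  by apply: contra ha => ha; apply/mapP; exists (a - nnval x); rewrite ?subrK.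
Qed.

Definition dsum_hom_fun : dg_car D -> M := dsum_map.
HB.instance Definition _ := GRing.isLinear.Build B (dg_car D) M *:%R dsum_hom_fun
  (dg_car_linear dsum_mapD dsum_mapZ dsum_mapX).

Lemma dsum_hom_gr a (u : module_of_diagram D) : pm_gr a u -> pm_gr a (dsum_hom_fun u).
Proof.
move=> hu; rewrite /dsum_hom_fun (@dsum_mapE _ [:: a]) //; last first.
  by move=> b; rewrite inE; exact: hu.
by rewrite big_seq1.
Qed.

Lemma module_of_diagram_iso : pm_iso (module_of_diagram D) M.
Proof.
apply: (@pm_iso_bij _ _ _ (module_of_diagram D) M
  (@PMHom _ _ _ (module_of_diagram D) M dsum_hom_fun dsum_hom_gr)) => [u|v].
  have [s hs] := dsfinP (u : W).
  have hs' a : a \notin undup s -> (u : W) a = 0 by rewrite mem_undup; exact: hs.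
  rewrite /= /dsum_hom_fun (@dsum_mapE _ (undup s)) ?undup_uniq // => u0.
  apply/(dsumP (u : W) 0) => a; have [as_|/hs' //] := boolP (a \in undup s).
  apply: alpha_inj.
  exact: (pm_ind (h := fun a => alpha ((u : W) a)) (undup_uniq s) _ u0 as_).
have [s [h [us hh e]]] := pm_dec_uniq v.
pose w a := projT1 (cid (alpha_surj (hh a))).
have hw a : alpha (w a) = h a by rewrite /w; case: cid.
have fP : exists t : seq 'rV[R]_n,
    forall a, a \notin t -> (if a \in s then w a else 0) = 0.
  by exists s => a /negbTE ->.
exists (DSum fP); rewrite /= /dsum_hom_fun (@dsum_mapE _ s) //=.
  by rewrite e; apply: eq_big_seq => a ->; rewrite hw.
by move=> a /negbTE ->.
Qed.

End DiagramModule.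

Lemma xpow_scale (k : fieldType) (R : realType) (n : nat)
    (M : lmodType (monoid_ring k R n)) (x y z : nnvec R n) (u : M) :
  nnval x + nnval y = nnval z -> xpow k x *: (xpow k y *: u) = xpow k z *: u.
Proof.
move=> e; have -> : z = nnvec_add x y by apply/val_inj.
by rewrite xpowD scalerA.
Qed.

Lemma xpow_scale3 (k : fieldType) (R : realType) (n : nat)
    (M : lmodType (monoid_ring k R n)) (x y z t : nnvec R n) (u : M) :
  nnval x + (nnval y + nnval z) = nnval t ->
  xpow k x *: (xpow k y *: (xpow k z *: u)) = xpow k t *: u.
Proof.
move=> e; have h := @xpow_scale k R n M y z (nnvec_add y z) u erefl.
exact: etrans (congr1 (fun v => xpow k x *: v) h)
  (@xpow_scale k R n M x (nnvec_add y z) t u e).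
Qed.

Lemma xpow_scale0 (k : fieldType) (R : realType) (n : nat)
    (M : lmodType (monoid_ring k R n)) (x : nnvec R n) (u : M) :
  nnval x = 0 -> xpow k x *: u = u.
Proof.
move=> e; have -> : x = nnvec0 R n by apply/val_inj.
by rewrite xpow0 scale1r.
Qed.

Lemma scale_linear (A : comNzRingType) (M : lmodType A) (x b : A) (u v : M) :
  x *: (b *: u + v) = b *: (x *: u) + x *: v.
Proof. by rewrite scalerDr !scalerA mulrC. Qed.

(** * Realization of interleaved modules *)

Section InterleavingDiagram.
Variables (k : fieldType) (R : realType) (n : nat) (M N : pmodule k R n).
Variables (e : {nonneg R}).
Variables (f : pm_hom M (Defs.shift N e%:num)) (g : pm_hom N (Defs.shift M e%:num)).
Hypothesis gf : forall u : M,
  shift_hom e%:num g (f u) = smoothing M (2 * e%:num)%:nng u :> M.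
Hypothesis fg : forall v : N,
  shift_hom e%:num f (g v) = smoothing N (2 * e%:num)%:nng v :> N.

Definition il_mod (s : bool) : pmodule k R n := if s then N else M.

Definition il_gap (s t : bool) : R := if s == t then 0 else e%:num.

Definition il_jump (s t : bool) : il_mod s -> il_mod t :=
  match s, t return il_mod s -> il_mod t with
  | false, false => fun u => u
  | false, true => fun u => f u
  | true, false => fun u => g u
  | true, true => fun u => u
  end.

Lemma il_jumpP s t b u v :
  il_jump (s := s) t (b *: u + v) = b *: il_jump t u + il_jump t v.
Proof. by case: s t u v => [] [] u v //=; rewrite linearP. Qed.

Lemma il_jumpZ s t b u : il_jump (s := s) t (b *: u) = b *: il_jump t u.
Proof. by case: s t u => [] [] u //=; rewrite linearZ. Qed.

Lemma il_jump_gr s t a u :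
  pm_gr a u -> pm_gr (a + const_mx (il_gap s t)) (il_jump (s := s) t u).
Proof.
have a0 : a + const_mx 0 = a by apply/rowP => j; rewrite !mxE addr0.
by case: s t u => [] [] u hu /=; rewrite /il_gap /= ?a0 //;
  [exact: (pmh_gr g hu)|exact: (pmh_gr f hu)].
Qed.

(** The excess of the two gaps over the direct one is 0 except on a round trip, where it is [2 * e]
    and the claim is an interleaving identity. *)
Lemma il_jump_comp s t r (x : nnvec R n) u :
  nnval x = const_mx (il_gap s t + il_gap t r - il_gap s r) ->
  il_jump (s := t) r (il_jump (s := s) t u) = xpow k x *: il_jump r u.
Proof.
rewrite /il_gap; case: s t r u => [] [] [] u /= hx; do ?
  [ by rewrite xpow_scale0 // hx; apply/rowP => j; rewrite !mxE; ring ].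
- have -> : x = nndiag n (2 * e%:num)%:nng.
    by apply/val_inj; rewrite /= hx; apply/rowP => j; rewrite !mxE; ring.
  exact: fg.
- have -> : x = nndiag n (2 * e%:num)%:nng.
    by apply/val_inj; rewrite /= hx; apply/rowP => j; rewrite !mxE; ring.
  exact: gf.
Qed.

(* [false] labels the grades of [M] and [true] those of [N]. *)
Definition il_le (p q : 'rV[R]_n * bool) : bool :=
  lev (p.1 + const_mx (il_gap p.2 q.2)) q.1.

Lemma il_gap_tri s t r : il_gap s r <= il_gap s t + il_gap t r.
Proof.
have e0 : 0 <= e%:num by []. rewrite /il_gap; move: e%:num e0 => x x0.
by case: s t r => [] [] [] /=; lra.
Qed.

Lemma il_le_refl p : il_le p p.
Proof. by apply/forallP => j; rewrite !mxE /il_gap eqxx addr0. Qed.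

Lemma il_le_trans p q r : il_le p q -> il_le q r -> il_le p r.
Proof.
move=> /forallP pq /forallP qr; apply/forallP => j.
have := pq j; have := qr j; have := il_gap_tri p.2 q.2 r.2.
rewrite !mxE; lra.
Qed.

Definition il_obj (p : 'rV[R]_n * bool) : lmodType k :=
  graded_piece (il_mod p.2) p.1.

Definition il_map_fun p q (h : il_le p q) (u : il_obj p) : il_obj q :=
  GradedPiece (transition_gr h (il_jump_gr q.2 (gp_valP u))).

Lemma il_map_linear p q (h : il_le p q) : linear (il_map_fun h).
Proof.
move=> c u v; apply: gp_inj; rewrite [RHS]gp_valP_linear [LHS]/= il_jumpP.
exact: scale_linear.
Qed.
HB.instance Definition _ p q (h : il_le p q) :=
  GRing.isLinear.Build k (il_obj p) (il_obj q) *:%R (il_map_fun h)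
    (il_map_linear h).

Definition il_map p q (h : il_le p q) : {linear il_obj p -> il_obj q} :=
  il_map_fun h.

Lemma il_map_id p (h : il_le p p) u : il_map h u = u.
Proof.
apply: gp_inj; rewrite /= /transition.
have -> : il_jump p.2 (gp_val u) = gp_val u.
  by case: p h u => [a []].
apply: xpow_scale0; rewrite /=; apply/rowP => j; rewrite !mxE /il_gap eqxx; ring.
Qed.

Lemma nndiagmP s t r :
  [forall j, 0 <= (const_mx (il_gap s t + il_gap t r - il_gap s r) : 'rV[R]_n) ord0 j].
Proof. by apply/forallP => j; rewrite mxE subr_ge0; exact: il_gap_tri. Qed.

Lemma il_map_comp p q r (hpq : il_le p q) (hqr : il_le q r) (hpr : il_le p r) u :
  il_map hqr (il_map hpq u) = il_map hpr u.
Proof.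
apply: gp_inj; rewrite /= /transition il_jumpZ.
rewrite (@il_jump_comp _ _ _ (NNVec (nndiagmP p.2 q.2 r.2))) //.
apply: xpow_scale3; rewrite /=; apply/rowP => j; rewrite !mxE; ring.
Qed.

Definition il_diagram : poset_diagram k ('rV[R]_n * bool) :=
  PosetDiagram il_le_refl il_le_trans il_map_id il_map_comp.

Definition il_space : topologicalType := alexandrov (node_preorder il_diagram).

(** The least [a] for which the grade of [t] is below [(a, s)]. *)
Definition il_fun (s : bool) (t : il_space) : 'rV[R]_n :=
  let p := nd_gr (t : node il_diagram) in p.1 + const_mx (il_gap p.2 s).

Lemma il_sup_dist s t : (sup_dist (il_fun s) (il_fun t) <= (e%:num)%:E)%E.
Proof.
rewrite /sup_dist ge_max lee_fin ge0 /=.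
apply: ge_ereal_sup => _ [x _ <-]; rewrite lee_fin; apply: mx_norm_le => // j.
rewrite /il_fun !mxE /il_gap opprD addrACA subrr add0r.
have : 0 <= e%:num by [].
by case: s t (nd_gr (x : node il_diagram)).2 => [] [] [] /= e0;
  rewrite ?subrr ?subr0 ?sub0r ?normrN ?normr0 // ger0_norm.
Qed.

Hypothesis kP : additive_scalable k.

Lemma il_funE s (t : il_space) a :
  lev (il_fun s t) a = pd_le il_diagram (nd_gr (t : node il_diagram)) (a, s).
Proof. by []. Qed.

Lemma il_realize s : pm_iso (sublevel_homology k (il_fun s) 1) (il_mod s).
Proof.
pose alpha a (u : sublevel_diagram k (il_fun s) 1 a) : il_mod s :=
  gp_val (sublevel_integral (il_funE s) u).
apply: (@module_of_diagram_iso _ _ _ _ _ alpha).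
- by move=> a u; exact: gp_valP.
- by move=> a c u v; rewrite /alpha sublevel_integral_linear.
- move=> a u u0; have [inj _] := sublevel_integral_bij (il_funE s) kP a.
  by apply: inj; apply: gp_inj.
- move=> a v hv; have [_ surj] := sublevel_integral_bij (il_funE s) kP a.
  by have [u hu] := surj (GradedPiece hv); exists u; rewrite /alpha hu.
move=> a b h u.
have h' : il_le (a, s) (b, s).
  by apply/forallP => j; rewrite !mxE /il_gap eqxx addr0; exact: (forallP h).
rewrite /alpha; have -> := sublevel_integral_natural (il_funE s) h h' u.
rewrite /= /transition.
have -> : nnsub h' = nnsub h.
  by apply/val_inj/rowP => j; rewrite !mxE /il_gap eqxx addr0.
by case: (s) (sublevel_integral _ _) => w.
Qed.

End InterleavingDiagram.

(** * Stability *)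

Section DiagramInterleaving.
Variables (k : fieldType) (R : realType) (n : nat).

(** Allowing every [b] above [a + e], and not just [a + e], avoids transport along equalities of
    degrees. *)
Record shift_family (D1 D2 : diagram k R n) (e : R) := ShiftFamily {
  sf_map : forall a b, lev (a + const_mx e) b -> {linear D1 a -> D2 b};
  sf_nat : forall a a' b b' (ha : lev a a') (hb : lev b b')
    (h : lev (a + const_mx e) b) (h' : lev (a' + const_mx e) b') u,
    dg_map D2 hb (sf_map h u) = sf_map h' (dg_map D1 ha u) }.

Section Hom.
Variables (D1 D2 : diagram k R n) (e : R) (m : shift_family D1 D2 e).

Lemma lev_sub_shift (b : 'rV[R]_n) : lev (b - const_mx e + const_mx e) b.
Proof. by rewrite subrK levv. Qed.

Definition sf_fun (u : dsum D1) b : D2 b :=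
  sf_map m (lev_sub_shift b) (u (b - const_mx e)).

Lemma sf_finP u : exists s : seq 'rV[R]_n, forall b, b \notin s -> sf_fun u b = 0.
Proof.
have [s hs] := dsfinP u; exists [seq a + const_mx e | a <- s] => b hb.
rewrite /sf_fun hs ?linear0 //; apply: contra hb => hb.
by apply/mapP; exists (b - const_mx e); rewrite ?subrK.
Qed.

Definition sf_dsum (u : dg_car D1) : dg_car D2 := DSum (sf_finP (u : dsum D1)).

Lemma sf_dsum_linear : linear sf_dsum.
Proof.
apply: (@dg_car_linear k R n D1 (dg_car D2) sf_dsum) => [u v|c u|x u].
- by apply/(@dsumP k _ D2) => b; rewrite /= /sf_fun dsumD linearD.
- rewrite [RHS](@action_moduleC k _ _ (dg_action D2)).
  by apply/(@dsumP k _ D2) => b; rewrite dsumZ /= /sf_fun dsumZ linearZ.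
rewrite [RHS](@action_moduleU k _ _ (dg_action D2)).
apply/(@dsumP k _ D2) => b; rewrite /= /dg_shift_fun /= /sf_fun.
have ha : lev (b - nnval x - const_mx e) (b - const_mx e).
  by apply/forallP => j; rewrite !mxE lerB // lerBlDr lerDl nnvec_ge0.
rewrite (sf_nat m ha _ _ (lev_sub_shift b)).
by congr (sf_map m _ _); rewrite /dg_shift_fun; apply: dg_map_eq; rewrite addrAC.
Qed.
HB.instance Definition _ := GRing.isLinear.Build (monoid_ring k R n)
  (dg_car D1) (dg_car D2) *:%R sf_dsum sf_dsum_linear.

Lemma sf_gr a (u : module_of_diagram D1) :
  pm_gr a u -> @pm_gr _ _ _ (Defs.shift (module_of_diagram D2) e) a (sf_dsum u).
Proof.
move=> hu b ba; rewrite /= /sf_fun hu ?linear0 //.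
by apply: contra ba => /eqP <-; rewrite subrK.
Qed.

Definition sf_hom :
    pm_hom (module_of_diagram D1) (Defs.shift (module_of_diagram D2) e) :=
  @PMHom _ _ _ (module_of_diagram D1)
    (Defs.shift (module_of_diagram D2) e) sf_dsum sf_gr.

End Hom.

Lemma sf_hom_comp (D1 D2 : diagram k R n) (e : {nonneg R})
    (m12 : shift_family D1 D2 e%:num) (m21 : shift_family D2 D1 e%:num) :
  (forall a b c (h : lev (a + const_mx e%:num) b) (h' : lev (b + const_mx e%:num) c)
    (hac : lev a c) u, sf_map m21 h' (sf_map m12 h u) = dg_map D1 hac u) ->
  forall u : module_of_diagram D1, shift_hom e%:num (sf_hom m21) (sf_hom m12 u) =
    smoothing (module_of_diagram D1) (2 * e%:num)%:nng u :> module_of_diagram D1.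
Proof.
move=> hm u.
rewrite [RHS](@action_moduleU k _ _ (dg_action D1) (nndiag n (2 * e%:num)%:nng)).
apply/(@dsumP k _ D1) => b; rewrite /= /sf_fun /= /sf_fun /dg_shift_fun /=.
have h : lev (b - const_mx e%:num - const_mx e%:num) b.
  by apply/forallP => j; rewrite !mxE; have : 0 <= e%:num by []; lra.
rewrite (hm _ _ _ _ _ h); apply: dg_map_eq.
by apply/rowP => j; rewrite !mxE; ring.
Qed.

Lemma sf_interleaved (D1 D2 : diagram k R n) (e : {nonneg R})
    (m12 : shift_family D1 D2 e%:num) (m21 : shift_family D2 D1 e%:num) :
  (forall a b c (h : lev (a + const_mx e%:num) b) (h' : lev (b + const_mx e%:num) c)
    (hac : lev a c) u, sf_map m21 h' (sf_map m12 h u) = dg_map D1 hac u) ->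
  (forall a b c (h : lev (a + const_mx e%:num) b) (h' : lev (b + const_mx e%:num) c)
    (hac : lev a c) u, sf_map m12 h' (sf_map m21 h u) = dg_map D2 hac u) ->
  interleaved e (module_of_diagram D1) (module_of_diagram D2).
Proof.
by move=> h1 h2; exists (sf_hom m12), (sf_hom m21); split; exact: sf_hom_comp.
Qed.

End DiagramInterleaving.

Section SublevelStability.
Variables (k : fieldType) (R : realType) (n : nat) (T : topologicalType).

Section Incl.
Variables (g1 g2 : T -> 'rV[R]_n) (e : R).
Hypothesis g12 : forall x, lev (g2 x) (g1 x + const_mx e).

Section Map.
Variables (a b : 'rV[R]_n) (h : lev (a + const_mx e) b).

Lemma shift_inclP (x : sublevel g1 a) : val x \in sublevel_set g2 b.
Proof.
apply/mem_set; apply: lev_trans (g12 _) _; apply: lev_trans h.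
by apply/forallP => j; rewrite !mxE lerD2r; exact: (forallP (set_valP x)).
Qed.

Definition shift_incl_fun (x : sublevel g1 a) : sublevel g2 b :=
  exist (fun y => is_true (y \in sublevel_set g2 b)) _ (shift_inclP x).

Lemma shift_incl_continuous : continuous shift_incl_fun.
Proof. apply: continuous_comp_initial; exact: initial_continuous. Qed.

Definition shift_incl : continuousType (sublevel g1 a) (sublevel g2 b) :=
  mkcts shift_incl_continuous.

End Map.

Variable i : nat.

Lemma shift_incl_nat a a' b b' (ha : lev a a') (hb : lev b b')
    (h : lev (a + const_mx e) b) (h' : lev (a' + const_mx e) b') u :
  dg_map (sublevel_diagram k g2 i) hb (homology_map k R (shift_incl h) i u) =
  homology_map k R (shift_incl h') i (dg_map (sublevel_diagram k g1 i) ha u).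
Proof.
transitivity (homology_map k R (shift_incl h' \o sublevel_incl g1 ha) i u).
  by apply: homology_map_comp => x; apply/val_inj.
by symmetry; apply: homology_map_comp => x; apply/val_inj.
Qed.

Definition sublevel_shift :
    shift_family (sublevel_diagram k g1 i) (sublevel_diagram k g2 i) e :=
  @ShiftFamily _ _ _ (sublevel_diagram k g1 i) (sublevel_diagram k g2 i) e
    (fun a b h => homology_map k R (shift_incl h) i) shift_incl_nat.

End Incl.

Lemma sublevel_interleaved (g1 g2 : T -> 'rV[R]_n) (e : {nonneg R}) i :
  (forall x, `|g1 x - g2 x| <= e%:num) ->
  interleaved e (sublevel_homology k g1 i) (sublevel_homology k g2 i).
Proof.
move=> he.
have le12 x : lev (g2 x) (g1 x + const_mx e%:num).
  apply/forallP => j; rewrite !mxE.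
  have := le_trans (mx_norm_ge (g1 x - g2 x) j) (he x).
  by rewrite !mxE ler_norml => /andP[]; lra.
have le21 x : lev (g1 x) (g2 x + const_mx e%:num).
  apply/forallP => j; rewrite !mxE.
  have := le_trans (mx_norm_ge (g1 x - g2 x) j) (he x).
  by rewrite !mxE ler_norml => /andP[]; lra.
apply: (sf_interleaved (m12 := sublevel_shift le12 i) (m21 := sublevel_shift le21 i)).
  by move=> a b c h h' hac u; apply: homology_map_comp => x; apply/val_inj.
by move=> a b c h h' hac u; apply: homology_map_comp => x; apply/val_inj.
Qed.

Lemma dI_sublevel_le (g1 g2 : T -> 'rV[R]_n) i :
  (dI (sublevel_homology k g1 i) (sublevel_homology k g2 i) <= sup_dist g1 g2)%E.
Proof.
have [ge0 _ _ _] := sup_dist_pseudometric R n T.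
case E : (sup_dist g1 g2) (ge0 g1 g2) => [r| |] // r0; last exact: leey.
rewrite lee_fin in r0; apply: ereal_inf_lbound.
exists (NngNum r0) => //; apply: sublevel_interleaved => x /=.
rewrite -lee_fin -E /sup_dist le_max; apply/orP; right.
by apply: ereal_sup_ubound; exists x.
Qed.

End SublevelStability.

(** * The interleaving distance is a pseudometric *)

Section InterleavingPseudometric.
Variables (k : fieldType) (R : realType) (n : nat).
Implicit Types M N P : pmodule k R n.

Lemma interleaved_sym e M N : interleaved e M N -> interleaved e N M.
Proof. by move=> [f [g [gf fg]]]; exists g, f. Qed.

Lemma interleaved_refl M : interleaved 0%:nng M M.
Proof.
have id_gr a (u : M) : pm_gr a u ->
    @pm_gr _ _ _ (Defs.shift M (0%:nng : {nonneg R})%:num) a (idfun u).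
  by rewrite /= (_ : a + const_mx 0 = a) //; apply/rowP => j; rewrite !mxE addr0.
pose f : pm_hom M (Defs.shift M (0%:nng : {nonneg R})%:num) :=
  @PMHom _ _ _ M (Defs.shift M (0%:nng : {nonneg R})%:num) idfun id_gr.
have h (u : M) : smoothing M (2 * (0%:nng : {nonneg R})%:num)%:nng u = u :> M.
  by apply: xpow_scale0; apply/rowP => j; rewrite !mxE /= mulr0.
by exists f, f; split=> u; rewrite h.
Qed.

Section Comp.
Variables (M N P : pmodule k R n) (e1 e2 e : {nonneg R}).
Hypothesis eE : e%:num = e1%:num + e2%:num.
Variables (f : pm_hom M (Defs.shift N e1%:num)) (g : pm_hom N (Defs.shift P e2%:num)).

Lemma shift_comp_gr a (u : M) : pm_gr a u ->
  @pm_gr _ _ _ (Defs.shift P e%:num) a (g (f u)).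
Proof.
move=> hu; have := pmh_gr g (pmh_gr f hu).
rewrite /= (_ : a + const_mx e1%:num + const_mx e2%:num = a + const_mx e%:num) //.
by apply/rowP => j; rewrite !mxE eE addrA.
Qed.

Definition shift_comp : pm_hom M (Defs.shift P e%:num) :=
  @PMHom _ _ _ M (Defs.shift P e%:num) (pmh_fun g \o pmh_fun f) shift_comp_gr.

End Comp.

Lemma interleaved_trans (e1 e2 e : {nonneg R}) M N P :
  e%:num = e1%:num + e2%:num ->
  interleaved e1 M N -> interleaved e2 N P -> interleaved e M P.
Proof.
move=> eE [f [g [gf fg]]] [f' [g' [gf' fg']]].
have eE' : e%:num = e2%:num + e1%:num by rewrite addrC.
exists (shift_comp eE f f'), (shift_comp eE' g' g); split=> u.
  (* The inner round trip is multiplication by a monomial, which [g] lets out by linearity; the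
     exponents of the two round trips add up. *)
  have h : g' (f' (f u)) = xpow k (nndiag n (2 * e2%:num)%:nng) *: (f u : N) :> N.
    exact: gf'.
  rewrite -[LHS]/(g (g' (f' (f u)))) h linearZ.
  have -> : g (f u) = xpow k (nndiag n (2 * e1%:num)%:nng) *: u :> M by exact: gf.
  by apply: xpow_scale; rewrite /=; apply/rowP => j; rewrite !mxE eE; ring.
have h : f (g (g' u)) = xpow k (nndiag n (2 * e1%:num)%:nng) *: (g' u : N) :> N.
  exact: fg.
rewrite -[LHS]/(f' (f (g (g' u)))) h linearZ.
have -> : f' (g' u) = xpow k (nndiag n (2 * e2%:num)%:nng) *: u :> P by exact: fg'.
by apply: xpow_scale; rewrite /=; apply/rowP => j; rewrite !mxE eE; ring.
Qed.

Lemma dI_ge0 M N : (0 <= dI M N)%E.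
Proof. by apply: le_ereal_inf_tmp => _ [e _ <-]; rewrite lee_fin. Qed.

Lemma dI_refl M : dI M M = 0%E.
Proof.
apply/eqP; rewrite eq_le dI_ge0 andbT; apply: ereal_inf_lbound.
by exists 0%:nng => //; exact: interleaved_refl.
Qed.

Lemma dI_sym M N : dI M N = dI N M.
Proof.
rewrite /dI; congr (ereal_inf (image _ _)).
by apply/seteqP; split=> e /=; exact: interleaved_sym.
Qed.

Lemma dI_tri M N P : (dI M P <= dI M N + dI N P)%E.
Proof.
have := dI_ge0 N P; have := dI_ge0 M N.
case E1 : (dI M N) => [r1| |] // r10; case E2 : (dI N P) => [r2| |] // r20;
  rewrite ?addye ?addey ?leey //.
apply/lee_addgt0Pr => d d0; have d20 : 0 < d / 2 by rewrite divr_gt0.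
have adh (A B : pmodule k R n) r : dI A B = r%:E ->
    exists2 e : {nonneg R}, interleaved e A B & e%:num < r + d / 2.
  move=> E; have fin : dI A B \is a fin_num by rewrite E.
  have [_ [e he <-]] := lb_ereal_inf_adherent d20 fin.
  by rewrite -/(dI A B) E -EFinD lte_fin => ?; exists e.
have [e1 he1 l1] := adh _ _ _ E1; have [e2 he2 l2] := adh _ _ _ E2.
apply: (@le_trans _ _ ((e1%:num + e2%:num)%:nng%:num)%:E).
  apply: ereal_inf_lbound; exists (e1%:num + e2%:num)%:nng => //.
  by apply: interleaved_trans he1 he2.
rewrite -!EFinD lee_fin /= [d]splitr addrACA.
by apply: ltW; apply: ltrD.
Qed.

Lemma dI_class_pseudometric : pseudometric (@dI_class k R n).
Proof.
split=> [x y|x|x y|x y z]; rewrite /dI_class.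
- exact: dI_ge0.
- exact: dI_refl.
- exact: dI_sym.
- exact: dI_tri.
Qed.

End InterleavingPseudometric.

(** * Optimality *)

Section Optimality.
Variables (k : fieldType) (R : realType) (n : nat).
Hypothesis kP : additive_scalable k.

Lemma class_repr_of (C : isoclass k R n) : class_of (class_repr C) = C.
Proof.
case: C => m hm; rewrite /class_repr /=; case: cid => N /= e.
by rewrite /class_of; move: (ex_intro _ _ _) => h; case: _ / (esym e) hm => hm;
  congr IsoClass; exact: Prop_irrelevance.
Qed.

Lemma interleaving_distance_optimal : optimal (R1 k R n) (@dI_class k R n).
Proof.
split.
  split; first exact: dI_class_pseudometric.
  by move=> [T i] g1 g2 /=; rewrite dI_classE; exact: dI_sublevel_le.
move=> d' [_ d'_stable] y1 y2 _ _; rewrite /dI_class /dI.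
(* It suffices to bound [d'] by [e] for one interleaving at a time; each has its own space. *)
apply: le_ereal_inf_tmp => _ [e [f [g [gf fg]]] <-].
rewrite -[X in d' X _]class_repr_of -[X in d' _ X]class_repr_of.
have /class_ofP <- := il_realize gf fg kP false.
have /class_ofP <- := il_realize gf fg kP true.
apply: le_trans (il_sup_dist gf fg false true).
exact: (d'_stable (il_space gf fg, 1%N)
  (il_fun (gf := gf) (fg := fg) false) (il_fun (gf := gf) (fg := fg) true)).
Qed.

End Optimality.

Theorem corollary2p10p2 (R : realType) (n : nat) (hn : (0 < n)%N) :
  optimal (R1 rat R n) (@dI_class rat R n) /\
  (forall p : nat, prime p -> optimal (R1 'F_p R n) (@dI_class 'F_p R n)).
Proof.
split; first exact: interleaving_distance_optimal rat_additive_scalable.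
move=> p _; apply: interleaving_distance_optimal.
exact: Fp_additive_scalable.
Qed.
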